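(* For every fixed $\varepsilon>0$ and every fixed prime $p$, the following holds for all positive integers $n$. For any subset $A\subseteq \mathbb{F}_p^n$ not containing distinct vectors $x_1,\dots,x_p\in A$ with $x_1+\dots+x_p=0$, we have $|A|\le D_{\varepsilon,p}\cdot (C_\varepsilon p^{\varepsilon})^n$. Here, $C_\varepsilon$ is a constant only depending on $\varepsilon$, and $D_{\varepsilon,p}$ is a constant only depending on $\varepsilon$ and $p$. *)

(* Defs.v *)
From HB Require Import structures.
From mathcomp Require Import all_boot all_order all_algebra.
From mathcomp Require Import all_reals exp.

Set Implicit Arguments.
Unset Strict Implicit.
Unset Printing Implicit Defensive.

Import Order.TTheory GRing.Theory Num.Theory.
Local Open Scope ring_scope.

Definition has_distinct_zero_sum (p n : nat) (A : {set 'rV['F_p]_n}) : Prop :=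
  exists x : 'I_p -> 'rV['F_p]_n,
    [/\ injective x, forall i, x i \in A & \sum_(i < p) x i = 0].

(* Main.v *)
Require Import Defs.
From HB Require Import structures.
From mathcomp Require Import all_boot all_order all_algebra.
From mathcomp Require Import finfield all_reals exp.
From mathcomp Require Import zify ring lra.

Set Implicit Arguments.
Unset Strict Implicit.
Unset Printing Implicit Defensive.

Import Order.TTheory GRing.Theory Num.Theory.
Local Open Scope ring_scope.

(* Call a sum of l elements of A popular if it can be realised by l distinct
   elements of A avoiding any prescribed set of at most p elements. It is enough
   to write 0 as a sum of p elements grouped into popular blocks.

   Popularity. If |A|^T > p^(4n), the collision probability of a sum of k
   random elements of A cannot keep dropping by a factor |A|^(1/4) along a
   bounded number of scales k. Hence on a long range of scales it is nearly
   constant, and there it is almost unchanged by some doubling k -> 2k. The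
   theorems of Balog--Szemeredi--Gowers and Pluennecke--Petridis then yield a
   large B in A whose l-fold sumset is so small, compared with the spread of the
   (l-1)-fold sums of A, that only a proportion |A|^(-c) of the l-tuples of B
   have an unpopular sum. A random subset I of B, still of exponential size,
   avoids all of these.

   Zero sums. By the slice rank method, in any set larger than C_kappa^n the
   equation x_1 + ... + x_s = s x_0 with s > p / kappa has a solution in which
   x_1, ..., x_s are not all equal. Starting from x + ... + x = 0 and repeatedly
   splitting the coincidence classes of size s, one finds in I a sum of p
   elements equal to 0 in which no value occurs more than p / kappa times. Its
   terms can be grouped into blocks of l distinct elements of I (and a shorter
   block of distinct elements), whose sums are popular. *)

(** * The slice rank bound *)

Lemma annihilator_product_bound (F : fieldType) (L R : nat) (J : finType)
    (m : 'I_R -> 'I_L -> F) :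
  (0 < #|J|)%N ->
  (forall h : J -> 'I_L -> F,
     (forall j e, \sum_t h j t * m e t = 0) ->
     exists c : 'I_R -> F, forall t, \prod_j h j t = \sum_e c e * m e t) ->
  (L <= 2 * R)%N.
Proof.
move=> /card_gt0P [j0 _] Hm.
pose E : 'M[F]_(L, R) := \matrix_(t, e) m e t.
pose mxf := maxrankfun E.
have span t : exists u : 'rV_(\rank E), row t E = u *m rowsub mxf E.
  by apply/submxP; rewrite (eq_maxrowsub E) row_sub.
have [u Hu] := fin_all_exists span.
pose D := ~: [set mxf i | i in 'I_(\rank E)].
pose h0 (t t' : 'I_L) : F := (t' == t)%:R - \sum_i u t 0 i * (t' == mxf i)%:R.
have h0D t t' : t' \in D -> h0 t t' = (t' == t)%:R.
  move=> Dt'; rewrite /h0 big1 ?subr0 // => i _.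
  case: eqP => [E'|]; last by rewrite mulr0.
  by move: Dt'; rewrite inE E' imset_f.
have h0A t e : \sum_t' h0 t t' * m e t' = 0.
  have delta (t1 : 'I_L) : \sum_t' (t' == t1)%:R * m e t' = m e t1.
    rewrite (bigD1 t1) //= eqxx mul1r big1 ?addr0 // => i /negbTE ->.
    by rewrite mul0r.
  under eq_bigr do rewrite mulrBl.
  rewrite sumrB delta.
  have -> : m e t = \sum_i u t 0 i * m e (mxf i).
    have /rowP /(_ e) := Hu t; rewrite !mxE => ->.
    by apply: eq_bigr => i _; rewrite !mxE.
  apply/eqP; rewrite subr_eq0; apply/eqP.
  under [RHS]eq_bigr do rewrite mulr_suml.
  rewrite exchange_big /=; apply: eq_bigr => i _.
  by under [RHS]eq_bigr do rewrite -mulrA; rewrite -mulr_sumr delta.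
pose h1 t' := \sum_(t in D) h0 t t'.
have h1D t' : t' \in D -> h1 t' = 1.
  move=> Dt'; rewrite /h1 (bigD1 t') //= h0D // eqxx big1 ?addr0 // => t.
  by case/andP=> _ /negbTE; rewrite h0D // eq_sym => ->.
have h1A e : \sum_t' h1 t' * m e t' = 0.
  under eq_bigr do rewrite mulr_suml.
  by rewrite exchange_big /= big1 // => t _; apply: h0A.
pose f (i : 'I_#|D|) : 'I_L := enum_val i.
have fD i : f i \in D by apply: enum_valP.
have /fin_all_exists [c Hc] : forall i : 'I_#|D|, exists c : 'I_R -> F,
    forall i', (f i' == f i)%:R = \sum_e c e * m e (f i').
  move=> i.
  have [j e|c Hc] := Hm (fun j => if j == j0 then h0 (f i) else h1).
    by case: ifP => _; [apply: h0A | apply: h1A].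
  exists c => i'; rewrite -Hc (bigD1 j0) //= eqxx h0D // big1 ?mulr1 // => j.
  by move=> /negbTE ->; rewrite h1D.
have leDR : (#|D| <= R)%N.
  apply: (@mulmx1_min F _ _ (rowsub f E) (\matrix_(e, i) c i e)).
  apply/matrixP=> i' i; rewrite !mxE -(inj_eq (@enum_val_inj _ (mem D))) Hc.
  by apply: eq_bigr => e _; rewrite !mxE mulrC.
have leR : (\rank E <= R)%N by apply: rank_leq_col.
have := cardsC [set mxf i | i in 'I_(\rank E)].
rewrite card_ord => <-.
rewrite card_imset ?card_ord; last exact: maxrankfun_inj.
by rewrite mul2n -addnn leq_add.
Qed.

Section LowDegree.
Variables (F : fieldType) (J : finType) (n : nat).
Implicit Types (P : (J -> 'rV[F]_n) -> F).

Definition monomial (e : 'I_n -> nat) (x : 'rV[F]_n) : F := \prod_t x 0 t ^+ e t.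

Definition poly_degree_le (D : nat) P : Prop :=
  exists (K : finType) (c : K -> F) (e : K -> J -> 'I_n -> nat),
    (forall k, \sum_j \sum_t e k j t <= D)%N /\
    (forall x, P x = \sum_k c k * \prod_j monomial (e k j) (x j)).

Lemma poly_degree_const D a : poly_degree_le D (fun=> a).
Proof.
exists unit, (fun=> a), (fun _ _ _ => 0%N); split=> [_|x].
  by rewrite big1 // => j _; rewrite big1.
rewrite big_const card_unit /= addr0 big1 ?mulr1 // => j _.
by rewrite /monomial big1 // => t _; rewrite expr0.
Qed.

Lemma poly_degree_var j t : poly_degree_le 1 (fun x => x j 0 t).
Proof.
exists unit, (fun=> 1), (fun _ j' t' => (j' == j) && (t' == t) : nat).
split=> [_|x].
  rewrite (bigD1 j) //= (bigD1 t) //= !eqxx /= big1 => [|t' /negbTE ->] //.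
  rewrite big1 // => j' /negbTE ->.
  by rewrite big1.
rewrite big_const card_unit /= addr0 mul1r (bigD1 j) //= /monomial.
rewrite (bigD1 t) //= !eqxx /= expr1 big1 => [|t' /negbTE ->]; last first.
  by rewrite expr0.
rewrite mulr1 big1 ?mulr1 // => j' /negbTE ->.
by rewrite big1 // => t' _; rewrite expr0.
Qed.

Lemma poly_degree_add D P Q :
  poly_degree_le D P -> poly_degree_le D Q ->
  poly_degree_le D (fun x => P x + Q x).
Proof.
case=> [K [c [e [He HP]]]] [K' [c' [e' [He' HQ]]]].
exists (K + K')%type, (fun k => match k with inl a => c a | inr b => c' b end).
exists (fun k => match k with inl a => e a | inr b => e' b end).
by split=> [[k|k]|x] //; rewrite HP HQ big_sumType.
Qed.

Lemma poly_degree_mul D D' P Q :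
  poly_degree_le D P -> poly_degree_le D' Q ->
  poly_degree_le (D + D') (fun x => P x * Q x).
Proof.
case=> [K [c [e [He HP]]]] [K' [c' [e' [He' HQ]]]].
exists (K * K')%type, (fun k => c k.1 * c' k.2).
exists (fun k j t => (e k.1 j t + e' k.2 j t)%N); split=> [[k k']|x] /=.
  under eq_bigr do rewrite big_split /=.
  by rewrite big_split leq_add.
rewrite HP HQ mulr_suml.
under [LHS]eq_bigr do rewrite mulr_sumr.
rewrite pair_big /=; apply: eq_bigr => -[k k'] _ /=.
rewrite mulrACA -big_split /=; congr (_ * _); apply: eq_bigr => j _.
by rewrite -big_split /=; apply: eq_bigr => t _; rewrite exprD.
Qed.

Lemma poly_degree_exp D P r :
  poly_degree_le D P -> poly_degree_le (D * r) (fun x => P x ^+ r).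
Proof.
move=> HP; elim: r => [|r IH]; first by rewrite muln0; apply: poly_degree_const.
have [K [c [e [He Hx]]]] := poly_degree_mul HP IH.
by rewrite mulnS; exists K, c, e; split=> // x; rewrite -Hx exprS.
Qed.

Lemma poly_degree_prod D (I : Type) (s : seq I) (P : I -> (J -> 'rV[F]_n) -> F) :
  (forall i, poly_degree_le D (P i)) ->
  poly_degree_le (D * size s) (fun x => \prod_(i <- s) P i x).
Proof.
move=> HP; elim: s => [|i s IH].
  have [K [c [e [He Hx]]]] := poly_degree_const (D * 0) 1.
  by exists K, c, e; split=> // x; rewrite -Hx big_nil.
have [K [c [e [He Hx]]]] := poly_degree_mul (HP i) IH.
by exists K, c, e; split=> [k|x]; rewrite ?mulnS // big_cons Hx.
Qed.

Lemma poly_degree_sum D (I : Type) (s : seq I) (P : I -> (J -> 'rV[F]_n) -> F) :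
  (forall i, poly_degree_le D (P i)) ->
  poly_degree_le D (fun x => \sum_(i <- s) P i x).
Proof.
move=> HP; elim: s => [|i s IH].
  have [K [c [e [He Hx]]]] := poly_degree_const D 0.
  by exists K, c, e; split=> // x; rewrite -Hx big_nil.
have [K [c [e [He Hx]]]] := poly_degree_add (HP i) IH.
by exists K, c, e; split=> [k|x] //; rewrite big_cons Hx.
Qed.

End LowDegree.

Lemma big_option (R : Type) (idx : R) (op : Monoid.com_law idx) (J : finType)
    (f : option J -> R) :
  \big[op/idx]_j f j = op (f None) (\big[op/idx]_j f (Some j)).
Proof.
rewrite (bigD1 None) //=; congr (op _ _).
rewrite (reindex_omap Some id) //=; last by case.
by apply: eq_bigl => j; rewrite eqxx.
Qed.

Lemma expf_card_pred (p : nat) (y : 'F_p) : prime p ->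
  y ^+ p.-1 = (y != 0)%:R.
Proof.
move=> p_pr; have p_gt1 := prime_gt1 p_pr.
case: eqVneq => [->|y0] /=.
  by rewrite expr0n -subn1 subn_eq0 leqNgt p_gt1.
apply: (mulfI y0); rewrite mulr1 -exprS prednK ?prime_gt0 //.
by have := expf_card y; rewrite card_Fp.
Qed.

Lemma indicator_zero_prod (p n : nat) (y : 'rV['F_p]_n) : prime p ->
  \prod_t (1 - y 0 t ^+ p.-1) = (y == 0)%:R.
Proof.
move=> p_pr; case: eqVneq => [->|y0].
  by rewrite big1 // => t _; rewrite mxE expf_card_pred // eqxx subr0.
have [t yt] : exists t, y 0 t != 0.
  by apply/existsP; rewrite -negb_forall; apply: contra y0 => /forallP y0;
     apply/eqP/rowP=> t; rewrite mxE; apply/eqP.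
by rewrite (bigD1 t) //= expf_card_pred // yt subrr mul0r.
Qed.

Definition small_exponents (n d : nat) : {set n.-tuple 'I_d.+1} :=
  [set e : n.-tuple 'I_d.+1 | (\sum_(i <- e) i <= d)%N].

Lemma card_small_exponents n d : (#|small_exponents n d| <= 2 ^ (n + d))%N.
Proof.
rewrite card_partial_ord_partitions.
have -> : (2 ^ (n + d) = \sum_(i < (n + d).+1) 'C(n + d, i))%N.
  by have := expnDn 1 1 (n + d); under eq_bigr do rewrite !exp1n !muln1.
by rewrite (bigD1 (inord n)) //= inordK ?leq_addr // ltnS leq_addr.
Qed.

Lemma small_exponentsP n d (e : 'I_n -> nat) : (\sum_t e t <= d)%N ->
  exists2 e' : n.-tuple 'I_d.+1, e' \in small_exponents n d &
    forall t, tnth e' t = e t :> nat.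
Proof.
move=> He.
have le_ed t : (e t < d.+1)%N.
  by rewrite ltnS (leq_trans _ He) // (bigD1 t) //= leq_addr.
exists [tuple inord (e t) | t < n] => [|t]; last by rewrite tnth_mktuple inordK.
rewrite inE big_tuple.
by under eq_bigr do rewrite tnth_mktuple inordK //.
Qed.

(* The slice-rank argument of Tao for the diagonal tensor
   [\sum_j x (i j) = #|J| x i0]: a product of functions on the index set
   annihilating the monomials of degree at most [n * kappa] is again a
   combination of such monomials. *)
Lemma nontrivial_barycentre (p n kappa L : nat) (J : finType)
    (x : 'I_L -> 'rV['F_p]_n) :
  prime p -> injective x -> (0 < #|J| < p)%N -> (p <= #|J| * kappa)%N ->
  (2 * 2 ^ (n + n * kappa) < L)%N ->
  exists (i0 : 'I_L) (i : J -> 'I_L),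
    (exists j j', i j != i j') /\ \sum_j x (i j) = x i0 *+ #|J|.
Proof.
move=> p_pr x_inj /andP [J_gt0 J_ltp] leJk ltL.
pose d := (n * kappa)%N; pose R := #|small_exponents n d|.
pose diagonal (i0 : 'I_L) (i : {ffun J -> 'I_L}) := [forall j, i j == i0].
pose sol (i0 : 'I_L) (i : {ffun J -> 'I_L}) := \sum_j x (i j) - x i0 *+ #|J| == 0.
case: (pickP [pred ii : 'I_L * {ffun J -> 'I_L} |
               sol ii.1 ii.2 && ~~ diagonal ii.1 ii.2]) => [[i0 i] /=|no].
  case/andP; rewrite /sol subr_eq0 => /eqP Hs Hd; exists i0, i; split=> //.
  move: Hd; rewrite negb_forall => /existsP [j Hj].
  case: (pickP [pred j' | i j' != i j]) => [j' /= Hj'|all_eq].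
    by exists j', j.
  case/negP: Hj; apply/eqP/x_inj.
  have ij : forall j', i j' = i j by move=> j'; apply/eqP/negbFE/all_eq.
  have : (x (i j) - x i0) *+ #|J| = 0.
    rewrite mulrnBl -Hs; under eq_bigr do rewrite ij.
    by rewrite sumr_const subrr.
  move=> /rowP E; apply/rowP=> t; have /eqP := E t.
  rewrite mulmxnE !mxE -mulr_natr mulf_eq0.
  case/orP => [|/eqP J0]; first by rewrite subr_eq0 => /eqP.
  have : (p %| #|J|)%N by rewrite (dvdn_pcharf (pchar_Fp p_pr)) J0.
  by move=> /(dvdn_leq J_gt0); rewrite leqNgt J_ltp.
have sol_diag i0 i : sol i0 i = diagonal i0 i.
  apply/idP/idP => [Hs|/forallP Hd].
    by have /negbT := no (i0, i); rewrite /= Hs /= negbK.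
  rewrite /sol (eq_bigr (fun=> x i0)) ?sumr_const ?subrr // => j _.
  by rewrite (eqP (Hd j)).
suff : (L <= 2 * R)%N.
  move=> leL; exfalso; move: ltL; rewrite ltnNge => /negP; apply.
  by apply: (leq_trans leL); rewrite leq_mul2l card_small_exponents orbT.
pose mono (e : n.-tuple 'I_d.+1) := @monomial 'F_p n (fun t => tnth e t).
pose m (e : 'I_R) (i : 'I_L) := mono (enum_val e) (x i).
apply: (@annihilator_product_bound 'F_p L R J m J_gt0) => h Hh.
pose a (j : option J) : 'F_p := if j is Some _ then 1 else - (#|J|%:R).
pose P (y : option J -> 'rV['F_p]_n) : 'F_p :=
  \prod_t (1 - (\sum_j a j * y j 0 t) ^+ p.-1).
have [K [c [e [He HP]]]] : poly_degree_le (p.-1 * n) P.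
  have -> : (p.-1 * n = (1 * p.-1) * size (index_enum 'I_n))%N.
    by rewrite mul1n; congr (_ * _)%N; rewrite -{1}(card_ord n) cardT enumT.
  apply: poly_degree_prod => t.
  apply: poly_degree_add; first exact: poly_degree_const.
  have -> : (1 * p.-1 = 0 + 1 * p.-1)%N by [].
  have [K [c [e [He Hx]]]] := poly_degree_mul (@poly_degree_const 'F_p (option J) n 0 (-1))
    (poly_degree_exp p.-1 (@poly_degree_sum 'F_p (option J) n 1 _
      (index_enum (option J)) (fun j y => a j * y j 0 t) (fun j =>
      poly_degree_mul (@poly_degree_const 'F_p (option J) n 0 (a j))
        (@poly_degree_var 'F_p (option J) n j t)))).
  by exists K, c, e; split=> // y; rewrite -Hx mulN1r.
pose y i0 (i : {ffun J -> 'I_L}) (j : option J) :=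
  x (if j is Some j' then i j' else i0).
have Py i0 i : P (y i0 i) = (diagonal i0 i)%:R.
  rewrite -sol_diag /sol -indicator_zero_prod //; apply: eq_bigr => t _.
  congr (1 - _ ^+ _); rewrite big_option /= /a mxE mxE summxE mulmxnE.
  rewrite mulNr mulr_natl addrC; congr (_ - _).
  by apply: eq_bigr => j _; rewrite mul1r.
have prod_h i0 : \prod_j h j i0 = \sum_i P (y i0 i) * \prod_j h j (i j).
  rewrite (bigD1 [ffun=> i0]) //= Py.
  have -> : diagonal i0 [ffun=> i0] by apply/forallP=> j; rewrite ffunE.
  rewrite mul1r [X in _ + X]big1 ?addr0 => [|i Hi].
    by apply: eq_bigr => j _; rewrite ffunE.
  rewrite Py (_ : diagonal i0 i = false) ?mul0r //.
  apply/negbTE; apply: contra Hi => /forallP Hd.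
  by apply/eqP/ffunP=> j; rewrite ffunE (eqP (Hd j)).
pose q k j := \sum_i h j i * monomial (e k (Some j)) (x i).
have expand i0 : \prod_j h j i0 =
    \sum_k (c k * \prod_j q k j) * monomial (e k None) (x i0).
  rewrite prod_h; under eq_bigr do rewrite HP mulr_suml.
  rewrite exchange_big /=; apply: eq_bigr => k _.
  rewrite bigA_distr_bigA mulrAC mulr_sumr /=; apply: eq_bigr => i _.
  rewrite big_option /= big_split /= -!mulrA; congr (_ * (_ * _)).
  by rewrite mulrC.
have zero k : (d < \sum_t e k None t)%N -> \prod_j q k j = 0.
  move=> Hk; suff /existsP [j Hj] : [exists j, (\sum_t e k (Some j) t <= d)%N].
    rewrite (bigD1 j) //=; have [e' He' Ee'] := small_exponentsP Hj.
    suff -> : q k j = 0 by rewrite mul0r.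
    apply: etrans (Hh j (enum_rank_in He' e')); apply: eq_bigr => i _.
    rewrite /m enum_rankK_in // /mono; congr (_ * _).
    by apply: eq_bigr => t _; rewrite Ee'.
  apply/existsP; case: (pickP [pred j | (\sum_t e k (Some j) t <= d)%N]) => [j Hj|H].
    by exists j.
  have := He k; rewrite big_option /= leqNgt => /negP []; rewrite -addn1 addnC.
  apply: leq_add; first exact: leq_ltn_trans Hk.
  apply: (@leq_trans (\sum_(j : J) d)%N); last first.
    by apply: leq_sum => j _; apply: ltnW; rewrite ltnNge; apply/negbT/H.
  rewrite sum_nat_const /d mulnCA mulnC leq_mul2l; apply/orP; right.
  by apply: leq_trans leJk; apply: leq_pred.
have /fin_all_exists [c' Hc'] : forall k, exists c' : 'I_R -> 'F_p, forall i0,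
    (c k * \prod_j q k j) * monomial (e k None) (x i0) = \sum_l c' l * m l i0.
  move=> k; case: (leqP (\sum_t e k None t) d) => [Hk|/zero ->]; last first.
    exists (fun=> 0) => i0; rewrite mulr0 mul0r big1 // => l _.
    by rewrite mul0r.
  have [e' He' Ee'] := small_exponentsP Hk.
  exists (fun l => (l == enum_rank_in He' e')%:R * (c k * \prod_j q k j)) => i0.
  rewrite (bigD1 (enum_rank_in He' e')) //= eqxx mul1r [X in _ = _ + X]big1 ?addr0.
    rewrite /m enum_rankK_in // /mono; congr (_ * _).
    by apply: eq_bigr => t _; rewrite Ee'.
  by move=> l /negbTE ->; rewrite !mul0r.
exists (fun l => \sum_k c' k l) => i0.
rewrite expand; under eq_bigr do rewrite Hc'.
rewrite exchange_big /=; apply: eq_bigr => l _.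
by rewrite mulr_suml.
Qed.

(** * Balanced zero sums *)

Lemma leq_card_bigcup (I T : finType) (P : pred I) (f : I -> {set T}) :
  (#|\bigcup_(i | P i) f i| <= \sum_(i | P i) #|f i|)%N.
Proof.
elim/big_rec2: _ => [|i m B _ IH]; first by rewrite cards0.
by rewrite (leq_trans (leq_card_setU _ _)) // leq_add2l.
Qed.

Lemma subset_of_card (T : finType) (A : {set T}) s : (s <= #|A|)%N ->
  exists2 B : {set T}, B \subset A & #|B| = s.
Proof.
move=> les; exists [set x in take s (enum A)].
  by apply/subsetP=> x; rewrite inE => /mem_take; rewrite mem_enum.
rewrite cardsE; have /card_uniqP -> := take_uniq s (enum_uniq A).
by rewrite size_takel // -cardE.
Qed.

Section BalancedSolutions.
Variables (p n kappa : nat).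
Hypotheses (p_pr : prime p) (p_gt2 : (2 < p)%N).
Hypotheses (kappa_gt1 : (1 < kappa)%N) (kappa_le : (kappa <= p)%N).
Variable I : {set 'rV['F_p]_n}.
Notation V := 'rV['F_p]_n.

Definition coincidences (x : {ffun 'I_p -> V}) : {set 'I_p * 'I_p} :=
  [set q | x q.1 == x q.2].

Definition solution_avoiding (U : {set V}) K (x : {ffun 'I_p -> V}) :=
  [&& [forall j, x j \in I :\: U], \sum_j x j == 0 & coincidences x == K].

Definition robust K (u : nat) :=
  [forall U : {set V}, (#|U| <= u)%N ==> [exists x, solution_avoiding U K x]].

Let L := (2 * 2 ^ (n + n * kappa)).+1.
Let u (c : nat) := (p * L * (2 ^ (p * p)).+1 ^ c)%N.

Lemma disjoint_solutions K (U : {set V}) m :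
  robust K (u #|K|) -> (#|U| + p * m <= u #|K|)%N ->
  exists y : nat -> {ffun 'I_p -> V},
    (forall i, (i < m)%N -> solution_avoiding U K (y i)) /\
    (forall i i', (i' < i < m)%N -> forall j j', y i j != y i' j').
Proof.
move=> robK; elim: m => [|m IH] leU.
  by exists (fun=> [ffun=> 0]); split=> // i i'; rewrite ltn0 andbF.
have [|y [ysol ydis]] := IH.
  by rewrite (leq_trans _ leU) // leq_add2l leq_mul2l leqnSn orbT.
pose W := U :|: \bigcup_(i < m) [set y i j | j in 'I_p].
have leW : (#|W| <= u #|K|)%N.
  apply: leq_trans leU; rewrite (leq_trans (leq_card_setU _ _)) // leq_add2l.
  apply: (leq_trans (leq_card_bigcup _ _)).
  apply: (@leq_trans (\sum_(i < m) p)%N).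
    by apply: leq_sum => i _; rewrite (leq_trans (leq_imset_card _ _)) // card_ord.
  by rewrite sum_nat_const card_ord mulnC leq_mul2l leqnSn orbT.
have /existsP [x /and3P [/forallP xI xs xK]] := implyP (forallP robK W) leW.
exists (fun i => if i == m then x else y i); split=> [i|i i' /andP [lt_i'i]].
  rewrite ltnS leq_eqVlt; case: eqP => [_ _|_ /= /ysol //].
  apply/and3P; split=> //; apply/forallP => j.
  by have := xI j; rewrite !inE negb_or => /andP [/andP [->]].
rewrite ltnS leq_eqVlt => /orP [/eqP Ei|lt_im] j j'.
  rewrite -Ei eqxx (ltn_eqF lt_i'i); have := xI j.
  rewrite !inE negb_or -andbA => /and3P [_ + _]; apply: contra => /eqP ->.
  have lt_i'm : (i' < m)%N by rewrite -Ei.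
  apply/bigcupP; exists (Ordinal lt_i'm) => //=.
  by apply: imset_f.
by rewrite (ltn_eqF lt_im) (ltn_eqF (ltn_trans lt_i'i lt_im)) ydis // lt_i'i.
Qed.

Lemma cross_solution K U (y : nat -> {ffun 'I_p -> V}) (j0 : 'I_p) :
  (forall i, (i < L)%N -> solution_avoiding U K (y i)) ->
  (forall i i', (i' < i < L)%N -> forall j j', y i j != y i' j') ->
  (p < #|[set j | (j0, j) \in K]| * kappa)%N ->
  exists x K', solution_avoiding U K' x /\ K' \proper K.
Proof.
move=> ysol ydis big_class.
pose C := [set j | (j0, j) \in K]; pose s := (p %/ kappa).+1.
have kappa_gt0 : (0 < kappa)%N by apply: ltnW.
have [c /subsetP cC card_c] : exists2 c : {set 'I_p}, c \subset C & #|c| = s.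
  by apply: subset_of_card; rewrite /s ltn_divLR.
have yinj i i' j j' : (i < L)%N -> (i' < L)%N -> y i j = y i' j' -> i = i'.
  move=> iL i'L E; case: (ltngtP i i') => // lt_ii'.
    by have := ydis i' i; rewrite lt_ii' i'L => /(_ isT j' j); rewrite E eqxx.
  by have := ydis i i'; rewrite lt_ii' iL => /(_ isT j j'); rewrite E eqxx.
have yK i j j' : (i < L)%N -> (y i j == y i j') = ((j, j') \in K).
  by move=> /ysol /and3P [_ _ /eqP <-]; rewrite inE.
have s_gt0 : (0 < #|{: {j | j \in c}}| < p)%N.
  rewrite card_sig card_c /=; apply: (@leq_trans (p %/ 2).+2).
    by rewrite !ltnS leq_div2l.
  by lia.
have les : (p <= #|{: {j | j \in c}}| * kappa)%N.
  by rewrite card_sig card_c ltnW // ltn_ceil.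
have [] := @nontrivial_barycentre p n kappa L {j | j \in c}
  (fun i : 'I_L => y i j0) p_pr _ s_gt0 les (ltnSn _).
  by move=> i i' E; apply: val_inj; apply: yinj E.
move=> i0 [i [[a [b iab]] Hsum]].
pose i' j : 'I_L := if insub j is Some j' then i j' else i0.
pose x := [ffun j => y (i' j) j].
have xK j j' : x j = x j' -> i' j = i' j' /\ (j, j') \in K.
  rewrite !ffunE => E; have Ei : i' j = i' j' by apply: val_inj; apply: yinj E.
  by split=> //; rewrite -(yK (i' j)) // {2}Ei E.
exists x, (coincidences x); split; last first.
  apply/properP; split.
    by apply/subsetP=> -[j j']; rewrite inE /= => /eqP /xK [].
  exists (val a, val b).
    have aC := cC _ (valP a); have bC := cC _ (valP b).
    rewrite !inE -!(yK 0%N) // in aC bC *.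
    by rewrite -(eqP aC).
  rewrite inE /=; apply: contra iab => /eqP /xK [].
  by rewrite /i' !valK => ->.
apply/and3P; split=> //.
  apply/forallP=> j; rewrite ffunE.
  by have /and3P [/forallP /(_ j)] := ysol _ (ltn_ord (i' j)).
rewrite (bigID (mem c)) /=.
have -> : \sum_(j in c) x j = \sum_(j in c) y i0 j.
  transitivity (y i0 j0 *+ #|c|).
    have <- : #|{: {j | j \in c}}| = #|c| by rewrite card_sig.
    rewrite -Hsum big_sub; apply: eq_bigr => j _.
    rewrite ffunE /i' valK; apply/eqP; rewrite eq_sym yK //.
    by have := cC _ (valP j); rewrite inE.
  rewrite -sumr_const; apply: eq_bigr => j /cC; rewrite inE -(yK i0) //.
  by move/eqP.
have -> : \sum_(j | j \notin c) x j = \sum_(j | j \notin c) y i0 j.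
  by apply: eq_bigr => j jc; rewrite ffunE /i' insubN.
have /and3P [_ + _] := ysol _ (ltn_ord i0).
by rewrite (bigID (mem c)).
Qed.

(* A robust coincidence pattern of minimal size has no large class: otherwise,
   crossing many disjoint solutions with this pattern would refine it. *)
Lemma exists_balanced_solution :
  (u (p * p) < #|I|)%N ->
  exists x : {ffun 'I_p -> V},
    [/\ forall j, x j \in I, \sum_j x j = 0 &
        forall v, (#|[set j | x j == v]| * kappa <= p)%N].
Proof.
move=> ltI.
have robT : robust setT (u #|[set: 'I_p * 'I_p]|).
  apply/forallP => U; apply/implyP; rewrite cardsT card_prod card_ord => leU.
  have : (0 < #|I :\: U|)%N.
    have := leq_ltn_trans leU ltI; rewrite -subn_gt0 => /leq_trans; apply.
    by rewrite cardsD leq_sub2l // subset_leq_card // subsetIr.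
  case/card_gt0P => v vI; apply/existsP; exists [ffun=> v].
  apply/and3P; split; first by apply/forallP=> j; rewrite ffunE.
    under eq_bigr do rewrite ffunE.
    rewrite sumr_const card_ord; apply/eqP/rowP=> t.
    by rewrite mulmxnE mxE -mulr_natr pchar_Fp_0 // mulr0.
  by apply/eqP/setP=> q; rewrite !inE !ffunE eqxx.
case: (@arg_minnP _ setT (fun K => robust K (u #|K|)) (fun K => #|K|) robT) => K robK minK.
have [|noex] := boolP [exists x : {ffun 'I_p -> V}, [&& [forall j, x j \in I],
    \sum_j x j == 0 & [forall v, (#|[set j | x j == v]| * kappa <= p)%N]]].
  case/existsP => x /and3P [/forallP ? /eqP ? /forallP ?].
  by exists x; split.
exfalso.
have big_class : exists j0, (p < #|[set j | (j0, j) \in K]| * kappa)%N.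
  have := forallP robK set0; rewrite cards0 /= => /existsP [x /and3P [/forallP xI xs /eqP xK]].
  move: noex; rewrite negb_exists => /forallP /(_ x); rewrite !negb_and.
  case/or3P => [/negP []|/negP [] //|].
    by apply/forallP=> j; have := xI j; rewrite setD0.
  case/forallPn => v; rewrite -ltnNge => Hv.
  have : (0 < #|[set j | x j == v]|)%N.
    by rewrite lt0n; apply: contraTneq Hv => ->.
  case/card_gt0P => j0; rewrite inE => /eqP xj0; exists j0.
  move: Hv; congr (_ < #|pred_of_set _| * _)%N.
  by apply/setP=> j; rewrite -xK !inE /= xj0 eq_sym.
have [j0 Hj0] := big_class.
have /fin_all_exists [U HU] : forall K' : {set 'I_p * 'I_p}, exists U : {set V}, K' \proper K ->
    (#|U| <= u #|K'|)%N /\ forall x, ~~ solution_avoiding U K' x.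
  move=> K'; have [Kp|_] := boolP (K' \proper K); last by exists set0.
  have : ~~ robust K' (u #|K'|).
    by apply: contraTN (proper_card Kp) => /minK; rewrite -leqNgt.
  case/forallPn => U; rewrite negb_imply => /andP [leU /existsPn H].
  by exists U.
pose W := \bigcup_(K' : {set 'I_p * 'I_p} | K' \proper K) U K'.
have leW : (#|W| + p * L <= u #|K|)%N.
  have K_gt0 : (0 < #|K|)%N.
    rewrite lt0n; apply: contraTneq Hj0 => /eqP; rewrite cards_eq0 => /eqP ->.
    rewrite (_ : [set _ | _] = set0) ?cards0 //.
    by apply/setP=> j; rewrite !inE.
  rewrite -(prednK K_gt0) /u expnS mulSn mulnDr addnC.
  apply: leq_add.
    by rewrite leq_pmulr // expn_gt0.
  apply: (leq_trans (leq_card_bigcup _ _)).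
  apply: (@leq_trans (\sum_(K' : {set 'I_p * 'I_p}) u #|K|.-1)%N).
    rewrite big_mkcond; apply: leq_sum => K' _; case: ifP => // HK'.
    have [leU _] := HU _ HK'; apply: (leq_trans leU).
    rewrite leq_mul2l leq_pexp2l ?orbT //.
    by rewrite -ltnS (prednK K_gt0) proper_card.
  by rewrite sum_nat_const -cardsT -powersetT card_powerset cardsT card_prod !card_ord /u mulnCA.
have [y [ysol ydis]] := disjoint_solutions robK leW.
have [x [K' [xsol HK']]] := cross_solution ysol ydis Hj0.
have [_ /(_ x) /negP []] := HU _ HK'.
case/and3P: xsol => /forallP xI xs xK; apply/and3P; split=> //.
apply/forallP=> j; have := xI j; rewrite !inE => /andP [+ ->].
rewrite andbT; apply: contra => xU; apply/bigcupP; by exists K'.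
Qed.

End BalancedSolutions.

(** * Additive combinatorics *)

Lemma cauchy_schwarz (R : realFieldType) (T : finType) (a b : T -> R) :
  (\sum_i a i * b i) ^+ 2 <= (\sum_i a i ^+ 2) * (\sum_i b i ^+ 2).
Proof.
rewrite -subr_ge0.
suff -> : (\sum_i a i ^+ 2) * (\sum_i b i ^+ 2) - (\sum_i a i * b i) ^+ 2 =
    2^-1 * \sum_i \sum_j (a i * b j - a j * b i) ^+ 2.
  rewrite mulr_ge0 ?invr_ge0 // sumr_ge0 // => i _.
  by rewrite sumr_ge0 // => j _; apply: sqr_ge0.
have E i j : (a i * b j - a j * b i) ^+ 2 =
    a i ^+ 2 * b j ^+ 2 + a j ^+ 2 * b i ^+ 2 - 2 * ((a i * b i) * (a j * b j)).
  by ring.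
under [in RHS]eq_bigr do under eq_bigr do rewrite E.
under [in RHS]eq_bigr do rewrite sumrB big_split /= -!mulr_sumr -mulr_suml.
rewrite sumrB big_split /= -mulr_suml -mulr_sumr -mulr_sumr -mulr_suml.
by field.
Qed.

Lemma weighted_average_ge (R : realFieldType) (T : finType) (f g : T -> R) c :
  (forall x, 0 <= f x) -> \sum_x f x = 1 -> c <= \sum_x f x * g x ->
  exists x, c <= g x.
Proof.
move=> f_ge0 f1 lec; case: (pickP [pred x | c <= g x]) => [x Hx|no]; first by exists x.
have lt_gc x : g x < c by rewrite ltNge (negbT (no x)).
have : \sum_x f x * (c - g x) = 0.
  apply/eqP; rewrite eq_le sumr_ge0 ?andbT => [|x _]; last first.
    by rewrite mulr_ge0 // subr_ge0 ltW.
  by under eq_bigr do rewrite mulrBr; rewrite sumrB -mulr_suml f1 mul1r subr_le0.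
move=> /psumr_eq0P E; have : \sum_x f x = 0.
  apply: big1 => x _; have /eqP : f x * (c - g x) = 0.
    by apply: E => // y _; rewrite mulr_ge0 // subr_ge0 ltW.
  by rewrite mulf_eq0 subr_eq0 (gt_eqF (lt_gc x)) orbF => /eqP.
by rewrite f1 => /eqP; rewrite oner_eq0.
Qed.

Lemma sum_triples (R : nmodType) (T : finType) (G : T * T * T -> R) :
  \sum_t G t = \sum_x \sum_y \sum_z G (x, y, z).
Proof. by rewrite pair_big pair_big; apply: eq_bigr => -[[x y] z]. Qed.

Lemma sum_shift (M : nmodType) (V : finZmodType) (g : V -> M) z :
  \sum_s g (s - z) = \sum_s g s.
Proof. by rewrite [RHS](reindex_inj (addIr (- z))). Qed.

Section BalogSzemerediGowers.
Variables (R : realFieldType) (V : finZmodType) (f : V -> R) (e Lam : R).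
Hypotheses (f_ge0 : forall x, 0 <= f x) (f_sum1 : \sum_x f x = 1).
Hypothesis f_sq : \sum_x f x ^+ 2 = e.
Let conv s := \sum_x f x * f (s - x).
Hypotheses (Lam_gt0 : 0 < Lam) (f_energy : e <= Lam * \sum_s conv s ^+ 2).

Let e_gt0 : 0 < e.
Proof.
rewrite lt_def -f_sq sumr_ge0 ?andbT => [|x _]; last exact: sqr_ge0.
apply/negP => /eqP /psumr_eq0P E.
have : \sum_x f x = 0.
  apply: big1 => x _; apply/eqP; rewrite -sqrf_eq0.
  by rewrite E // => y _; apply: sqr_ge0.
by rewrite f_sum1 => /eqP; rewrite oner_eq0.
Qed.

Let conv_le s : conv s <= e.
Proof.
suff : conv s <= 2^-1 * (\sum_x f x ^+ 2 + \sum_x f (s - x) ^+ 2).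
  move/le_trans; apply; rewrite [X in _ + X](_ : _ = e) ?f_sq; first by lra.
  rewrite -f_sq [RHS](reindex_inj (inv_inj (subKr s))) //=.
rewrite -big_split /= mulr_sumr; apply: ler_sum => x _.
have := sqr_ge0 (f x - f (s - x)); nra.
Qed.

Let conv_ge0 s : 0 <= conv s.
Proof. by apply: sumr_ge0 => x _; apply: mulr_ge0. Qed.

Let conv_sum1 : \sum_s conv s = 1.
Proof.
rewrite exchange_big /= -[RHS]f_sum1; apply: eq_bigr => x _.
by rewrite -mulr_sumr sum_shift f_sum1 mulr1.
Qed.

Let Q : {set V} := [set s | e <= 2 * Lam * conv s].
Let q (s : V) : R := (s \in Q)%:R.
Let alpha := \sum_s q s * conv s.

Let q_ge0 s : 0 <= q s. Proof. exact: ler0n. Qed.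

Let card_Q : #|Q|%:R * e <= 2 * Lam.
Proof.
have -> : 2 * Lam = \sum_s 2 * Lam * conv s by rewrite -mulr_sumr conv_sum1 mulr1.
rewrite mulr_natl -sumr_const.
rewrite [leRHS](bigID (mem Q)) /=; apply: ler_wpDr.
  by apply: sumr_ge0 => s _; rewrite !mulr_ge0 // ltW.
by apply: ler_sum => s; rewrite inE.
Qed.

Let alpha_ge : 1 <= 2 * Lam * alpha.
Proof.
have H : e <= Lam * e * alpha + e / 2 * 1.
  apply: (le_trans f_energy); rewrite -[X in _ <= _ + _ * X]conv_sum1 !mulr_sumr -big_split /=.
  apply: ler_sum => s _; rewrite /q inE.
  have := conv_ge0 s; have := conv_le s; have := Lam_gt0; have := e_gt0.
  move=> e0 L0 c1 c0; case: (boolP (e <= _)) => Hs /=.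
    have : Lam * (conv s * conv s) <= Lam * (e * conv s).
      by rewrite ler_pM2l // ler_wpM2r.
    have : 0 <= e * conv s by rewrite mulr_ge0 // ltW.
    by nra.
  have {}Hs : 2 * Lam * conv s <= e by rewrite ltW // ltNge.
  have : 2 * Lam * conv s * conv s <= e * conv s by rewrite ler_wpM2r.
  by nra.
have : e * 1 <= e * (2 * Lam * alpha) by nra.
by rewrite ler_pM2l.
Qed.

Let F z := \sum_x f x * q (x + z).
Let co x y := \sum_z f z * (q (x + z) * q (y + z)).
Let beta := alpha ^+ 2 / 16.
Let b x y : R := (co x y < beta)%R%:R.
Let Bad z := \sum_x \sum_y f x * f y * (q (x + z) * q (y + z)) * b x y.

Let alphaE : alpha = \sum_z f z * F z.
Proof.
rewrite /alpha /conv; under eq_bigr do rewrite mulr_sumr.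
rewrite exchange_big /=.
under [RHS]eq_bigr do rewrite mulr_sumr.
rewrite [RHS]exchange_big /=; apply: eq_bigr => x _.
rewrite -(sum_shift (fun z => f z * (f x * q (x + z))) x).
by apply: eq_bigr => s _; rewrite (addrC x) subrK; ring.
Qed.

Let alpha_gt0 : 0 < alpha.
Proof. by have := alpha_ge; have := Lam_gt0; nra. Qed.

Let F_ge0 z : 0 <= F z.
Proof. by apply: sumr_ge0 => x _; rewrite mulr_ge0. Qed.

Let sq_F : alpha ^+ 2 <= \sum_z f z * F z ^+ 2.
Proof.
have : 0 <= \sum_z f z * (F z - alpha) ^+ 2.
  by apply: sumr_ge0 => z _; rewrite mulr_ge0 // sqr_ge0.
have E z : f z * (F z - alpha) ^+ 2 =
  f z * F z ^+ 2 - 2 * alpha * (f z * F z) + alpha ^+ 2 * f z by ring.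
under eq_bigr do rewrite E.
rewrite big_split sumrB /= -!mulr_sumr -alphaE f_sum1; nra.
Qed.

Let avg_Bad : \sum_z f z * Bad z <= beta.
Proof.
have -> : \sum_z f z * Bad z = \sum_x \sum_y f x * f y * (b x y * co x y).
  rewrite /Bad; under eq_bigr do rewrite mulr_sumr.
  rewrite exchange_big /=; apply: eq_bigr => x _.
  under eq_bigr do rewrite mulr_sumr.
  rewrite exchange_big /=; apply: eq_bigr => y _.
  rewrite /co !mulr_sumr; apply: eq_bigr => z _; ring.
apply: (@le_trans _ _ (\sum_x \sum_y f x * f y * beta)).
  apply: ler_sum => x _; apply: ler_sum => y _.
  rewrite ler_wpM2l ?mulr_ge0 // /b; case: ltP => [/ltW|_]; first by rewrite mul1r.
  by rewrite mul0r /beta; have := alpha_gt0; nra.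
under eq_bigr do rewrite -mulr_suml -mulr_sumr f_sum1 mulr1.
by rewrite -mulr_suml f_sum1 mul1r.
Qed.

Let pivot : exists z, alpha ^+ 2 / 2 <= F z ^+ 2 - 8 * Bad z.
Proof.
apply: (@weighted_average_ge _ _ f) => //.
have E z : f z * (F z ^+ 2 - 8 * Bad z) = f z * F z ^+ 2 - 8 * (f z * Bad z) by ring.
under eq_bigr do rewrite E.
rewrite sumrB -mulr_sumr.
have := sq_F; have := avg_Bad; rewrite /beta; lra.
Qed.

Let triples x x' := [set t : V * V * V |
  [&& x + t.1.2 \in Q, t.1.1 + t.1.2 \in Q, t.1.1 + t.2 \in Q & x' + t.2 \in Q]].

Let weight_triples x x' :
  (\sum_y f y * (co x y * co x' y)) ^+ 2 <= e ^+ 3 * #|triples x x'|%:R.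
Proof.
pose g (t : V * V * V) := f t.1.1 * f t.1.2 * f t.2.
have -> : \sum_y f y * (co x y * co x' y) = \sum_t g t * (t \in triples x x')%:R.
  rewrite sum_triples; apply: eq_bigr => y _; rewrite /co mulr_suml mulr_sumr; apply: eq_bigr => z1 _.
  rewrite !mulr_sumr; apply: eq_bigr => z2 _.
  rewrite /g inE /= /q; do 4!case: (_ \in Q) => /=; ring.
apply: (le_trans (cauchy_schwarz _ _)); rewrite le_eqVlt; apply/orP; left; apply/eqP.
congr (_ * _).
  rewrite sum_triples.
  have E y z1 z2 : g (y, z1, z2) ^+ 2 = f y ^+ 2 * (f z1 ^+ 2 * f z2 ^+ 2).
    by rewrite /g /=; ring.
  under eq_bigr do under eq_bigr do under eq_bigr do rewrite E.
  under eq_bigr do under eq_bigr do rewrite -mulr_sumr -mulr_sumr f_sq.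
  under eq_bigr do rewrite -mulr_sumr -mulr_suml f_sq.
  by rewrite -mulr_suml f_sq; ring.
rewrite -sum1_card natr_sum [RHS]big_mkcond /=; apply: eq_bigr => t _.
by case: (t \in _); rewrite ?expr1n ?expr0n.
Qed.

Let quads (d : V) := [set u : V * V * V * V |
  [&& u.1.1.1 \in Q, u.1.1.2 \in Q, u.1.2 \in Q, u.2 \in Q &
      u.1.1.1 - u.1.1.2 + u.1.2 - u.2 == d]].

Let triples_quads x x' : (#|triples x x'| <= #|quads (x - x')%R|)%N.
Proof.
pose h (t : V * V * V) := (x + t.1.2, t.1.1 + t.1.2, t.1.1 + t.2, x' + t.2).
have h_inj : injective h.
  move=> [[y z1] z2] [[y' z1'] z2'] [] /= /addrI -> /addIr -> _ /addrI -> //.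
rewrite -(card_imset _ h_inj); apply: subset_leq_card; apply/subsetP => u.
case/imsetP => -[[y z1] z2] Ht ->; move: Ht; rewrite inE /=.
case/and4P => Q1 Q2 Q3 Q4; rewrite inE /= Q1 Q2 Q3 Q4 /=.
have E a c d : a + d - (c + d) = a - c :> V.
  by rewrite opprD addrACA subrr addr0.
by rewrite -addrA !E addrA subrK.
Qed.

Let sum_quads : (\sum_d #|quads d| <= #|Q| ^ 4)%N.
Proof.
have -> : (#|Q| ^ 4 = #|setX (setX (setX Q Q) Q) Q|)%N.
  by rewrite !cardsX; ring.
rewrite -sum1_card.
rewrite (partition_big (fun u : V * V * V * V => u.1.1.1 - u.1.1.2 + u.1.2 - u.2) xpredT) //=.
apply: leq_sum => d _; rewrite -sum1_card leq_eqVlt; apply/orP; left; apply/eqP.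
by apply: eq_bigl => -[[[u1 u2] u3] u4]; rewrite !inE /= -!andbA.
Qed.

Lemma balog_szemeredi_gowers : exists Y : {set V},
  1 <= 8 * Lam * \sum_(x in Y) f x /\
  #|[set x - y | x in Y, y in Y]|%:R * e <= 2 ^+ 33 * Lam ^+ 14.
Proof.
have [z Hz] := pivot.
pose bx x := \sum_y f y * q (y + z) * b x y.
pose Y := [set x | (x + z \in Q) && (4 * bx x <= F z)].
have b_ge0 x y : 0 <= b x y by apply: ler0n.
have bx_ge0 x : 0 <= bx x by apply: sumr_ge0 => y _; rewrite !mulr_ge0.
have BadE : Bad z = \sum_x f x * q (x + z) * bx x.
  apply: eq_bigr => x _; rewrite mulr_sumr; apply: eq_bigr => y _; ring.
have Bad_ge0 : 0 <= Bad z.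
  by rewrite BadE sumr_ge0 // => x _; rewrite !mulr_ge0.
have F2 : alpha ^+ 2 / 2 <= F z ^+ 2 by lra.
have a0 := alpha_gt0.
have F_gt0 : 0 < F z by have := F_ge0 z; nra.
pose fY := \sum_(x in Y) f x.
have fY_ge : F z <= 2 * fY.
  have : F z * F z <= F z * fY + 4 * Bad z.
    rewrite {2}/F BadE /fY !mulr_sumr [X in _ <= X + _]big_mkcond /= -big_split /=.
    apply: ler_sum => x _; rewrite inE /q.
    case: (x + z \in Q) => /=; last by rewrite !(mulr0, mul0r) addr0.
    rewrite !mulr1; case: ifP => H.
      by rewrite ler_wpDr // !mulr_ge0.
    rewrite add0r mulrC mulrCA ler_wpM2l // ltW // ltNge H //.
  by have := sqr_ge0 alpha; nra.
have La := alpha_ge.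
have LF : 1 <= 8 * Lam ^+ 2 * F z ^+ 2.
  have : 1 * 1 <= (2 * Lam * alpha) * (2 * Lam * alpha) by apply: ler_pM.
  by have := Lam_gt0; nra.
exists Y; split.
  have : 1 <= 4 * Lam * F z.
    rewrite -(@ler_pXn2r _ 2) ?nnegrE // ?expr1n; first by nra.
    by rewrite !mulr_ge0 // ltW.
  by rewrite -/fY; have := Lam_gt0; nra.
pose w := F z / 2 * beta ^+ 2.
have beta_gt0 : 0 < beta by rewrite /beta; nra.
have w_gt0 : 0 < w by apply: mulr_gt0; [apply: divr_gt0|apply: exprn_gt0].
have coY x x' : x \in Y -> x' \in Y -> w <= \sum_y f y * (co x y * co x' y).
  rewrite !inE => /andP [_ Hx] /andP [_ Hx'].
  apply: (@le_trans _ _ (\sum_y f y * q (y + z) * (1 - b x y) * (1 - b x' y) * beta ^+ 2)).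
    rewrite -mulr_suml /w ler_wpM2r ?sqr_ge0 //.
    apply: (@le_trans _ _ (F z - bx x - bx x')); first by lra.
    rewrite /F /bx -!sumrB; apply: ler_sum => y _.
    have fq : 0 <= f y * q (y + z) by rewrite mulr_ge0.
    by rewrite /b; case: (co x y < _); case: (co x' y < _) => /=; nra.
  apply: ler_sum => y _; rewrite -!mulrA ler_wpM2l //.
  have co_ge0 u v : 0 <= co u v by apply: sumr_ge0 => ? _; rewrite !mulr_ge0.
  have co2 : 0 <= co x y * co x' y by rewrite mulr_ge0.
  rewrite /b; case: ltP => [_|H1]; first by rewrite subrr !(mul0r, mulr0).
  case: ltP => [_|H2]; first by rewrite subrr !(mul0r, mulr0).
  rewrite !subr0 !mul1r expr2.
  have : beta * beta <= co x y * co x' y by apply: ler_pM => //; apply: ltW.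
  by rewrite /q; case: (_ \in Q) => /=; rewrite ?mul0r ?mul1r.
have e0 := e_gt0; have L0 := Lam_gt0.
have main : #|[set x - y | x in Y, y in Y]|%:R * w ^+ 2 <= e ^+ 3 * #|Q|%:R ^+ 4.
  rewrite mulr_natl -sumr_const -natrX.
  apply: (@le_trans _ _ (e ^+ 3 * (\sum_d #|quads d|)%:R)); last first.
    by rewrite ler_wpM2l ?ler_nat // exprn_ge0 // ltW.
  rewrite natr_sum mulr_sumr [leRHS](bigID (mem [set x - y | x in Y, y in Y])) /=.
  apply: ler_wpDr; first by apply: sumr_ge0 => d _; rewrite mulr_ge0 ?exprn_ge0 // ltW.
  apply: ler_sum => d /imset2P [x x' Yx Yx' ->].
  apply: (@le_trans _ _ ((\sum_y f y * (co x y * co x' y)) ^+ 2)).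
    by rewrite ler_pXn2r ?nnegrE ?coY // ?(le_trans (ltW w_gt0) (coY _ _ Yx Yx')) // ltW.
  apply: (le_trans (weight_triples _ _)); rewrite ler_wpM2l ?ler_nat //.
  by rewrite exprn_ge0 // ltW.
set N : R := #|_|%:R in main *.
have N_ge0 : 0 <= N by apply: ler0n.
have Qe4 : (#|Q|%:R * e) ^+ 4 <= (2 * Lam) ^+ 4.
  by rewrite ler_pXn2r ?nnegrE ?mulr_ge0 ?ler0n // ltW.
have beta4 : 1 <= (64 * Lam ^+ 2 * beta) ^+ 4.
  apply: exprn_ege1; have : 1 * 1 <= (2 * Lam * alpha) * (2 * Lam * alpha).
    by apply: ler_pM.
  by rewrite /beta; lra.
have w2 : 1 <= 2 ^+ 29 * Lam ^+ 10 * w ^+ 2.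
  have -> : 2 ^+ 29 * Lam ^+ 10 * w ^+ 2 =
      8 * Lam ^+ 2 * F z ^+ 2 * (64 * Lam ^+ 2 * beta) ^+ 4 by rewrite /w; field.
  by have := ler_pM ler01 ler01 LF beta4; rewrite mulr1.
have Nw : N * e * w ^+ 2 <= (2 * Lam) ^+ 4.
  apply: le_trans Qe4.
  have -> : (#|Q|%:R * e) ^+ 4 = e ^+ 3 * #|Q|%:R ^+ 4 * e by ring.
  by rewrite mulrAC ler_wpM2r // ltW.
apply: (@le_trans _ _ (N * e * (2 ^+ 29 * Lam ^+ 10 * w ^+ 2))).
  by rewrite ler_peMr // mulr_ge0 // ltW.
have -> : N * e * (2 ^+ 29 * Lam ^+ 10 * w ^+ 2) =
  2 ^+ 29 * Lam ^+ 10 * (N * e * w ^+ 2) by ring.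
have -> : 2 ^+ 33 * Lam ^+ 14 = 2 ^+ 29 * Lam ^+ 10 * (2 * Lam) ^+ 4 by ring.
by rewrite ler_wpM2l // mulr_ge0 // exprn_ge0 // ltW.
Qed.

End BalogSzemerediGowers.

Section Sumsets.
Variable V : finZmodType.
Implicit Types A B C X Y Z : {set V}.

Definition sumset A B : {set V} := [set x + y | x in A, y in B].

Definition translate A (c : V) : {set V} := [set x + c | x in A].

Fixpoint iterated_sumset A (k : nat) : {set V} :=
  if k is k'.+1 then sumset A (iterated_sumset A k') else [set 0].

Lemma mem_sumset A B x y : x \in A -> y \in B -> x + y \in sumset A B.
Proof. exact: imset2_f. Qed.

Lemma sumsetC A B : sumset A B = sumset B A.
Proof.
apply/setP=> s; apply/imset2P/imset2P => -[x y Hx Hy ->];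
  by exists y x => //; rewrite addrC.
Qed.

Lemma sumsetA A B C : sumset A (sumset B C) = sumset (sumset A B) C.
Proof.
apply/setP=> s; apply/imset2P/imset2P.
  case=> x _ Ax /imset2P [y z By Cz ->] ->.
  by exists (x + y) z => //; rewrite ?addrA // mem_sumset.
case=> _ z /imset2P [x y Ax By ->] Cz ->.
by exists x (y + z) => //; rewrite ?addrA // mem_sumset.
Qed.

Lemma sumset_subl A A' B : A \subset A' -> sumset A B \subset sumset A' B.
Proof.
by move=> /subsetP sAA'; apply/subsetP => s /imset2P [x y /sAA' ? ? ->];
  apply: mem_sumset.
Qed.

Lemma card_translate A c : #|translate A c| = #|A|.
Proof. by rewrite card_imset //; apply: addIr. Qed.

Lemma sumset1 A c : sumset A [set c] = translate A c.
Proof.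
apply/setP=> s; apply/imset2P/imsetP => [[x y Ax /set1P -> ->]|[x Ax ->]].
  by exists x.
by exists x c => //; rewrite inE.
Qed.

Lemma sumsetUr A B C : sumset A (B :|: C) = sumset A B :|: sumset A C.
Proof.
apply/setP=> s; rewrite inE; apply/imset2P/orP.
  by case=> x y Ax /setUP [Hy|Hy] ->; [left|right]; apply: mem_sumset.
by case=> /imset2P [x y Ax Hy ->]; exists x y => //; rewrite inE Hy ?orbT.
Qed.

Lemma petridis X B C :
  (forall Z, Z \subset X -> #|sumset X B| * #|Z| <= #|sumset Z B| * #|X|)%N ->
  (#|sumset (sumset X B) C| * #|X| <= #|sumset X B| * #|sumset X C|)%N.
Proof.
move=> minX; have [m] := ubnP #|C|; elim: m C => // m IH C leC.
have [->|[c Cc]] := set_0Vmem C.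
  rewrite (_ : sumset _ set0 = set0) ?cards0 //.
  by apply/setP=> s; rewrite inE; apply/negP => /imset2P [? ? _]; rewrite inE.
pose C' := C :\ c.
have C'E : C = C' :|: [set c] by rewrite setUC setD1K.
have /IH {}IH : (#|C'| < m)%N.
  by move: leC; rewrite (cardsD1 c) Cc.
pose XBC := sumset (sumset X B) C'.
pose Z := [set x in X | [forall y in B, x + y + c \in XBC]].
have sZX : Z \subset X by apply/subsetP => x; rewrite inE => /andP [].
have up : (#|sumset (sumset X B) C| + #|sumset Z B| <= #|XBC| + #|sumset X B|)%N.
  rewrite C'E sumsetUr -/XBC sumset1.
  apply: (@leq_trans (#|XBC| + #|translate (sumset X B :\: sumset Z B) c| + #|sumset Z B|)%N).
    rewrite leq_add2r; apply: leq_trans (leq_card_setU _ _); apply: subset_leq_card.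
    apply/subsetP => s /setUP [Hs|/imsetP [t Ht ->]]; apply/setUP; first by left.
    have [tZ|tZ] := boolP (t \in sumset Z B); last first.
      by right; apply: imset_f; rewrite inE tZ.
    left; case/imset2P: tZ => x y; rewrite inE => /andP [_ /forallP /(_ y)] + By ->.
    by rewrite By.
  rewrite card_translate -addnA leq_add2l cardsD.
  by rewrite (setIidPr (sumset_subl _ sZX)) subnK // subset_leq_card // sumset_subl.
have low : (#|sumset X C'| + #|X| <= #|sumset X C| + #|Z|)%N.
  rewrite C'E sumsetUr sumset1.
  pose Xc := translate X c.
  have leI : (#|sumset X C' :&: Xc| <= #|Z|)%N.
    rewrite -(card_translate Z c); apply: subset_leq_card; apply/subsetP => s.
    case/setIP => Hs /imsetP [x Xx Es]; rewrite Es in Hs *.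
    apply: imset_f; rewrite inE Xx; apply/forallP => y; apply/implyP => By.
    rewrite /XBC (sumsetC X) -sumsetA addrAC addrC.
    exact: mem_sumset.
  by rewrite -(card_translate X c) -/Xc -cardsUI leq_add2l.
have := minX _ sZX; move: IH; rewrite -/XBC => IH minZ.
have := leq_mul up (leqnn #|X|); have := leq_mul (leqnn #|sumset X B|) low.
rewrite !mulnDl !mulnDr; lia.
Qed.

Lemma plunnecke_minimizer A B : A != set0 ->
  exists X, [/\ X \subset A, X != set0,
    (#|sumset X B| * #|A| <= #|sumset A B| * #|X|)%N &
    forall j, (#|sumset X (iterated_sumset B j)| * #|X| ^ j <=
               #|sumset X B| ^ j * #|X|)%N].
Proof.
move=> A_neq0; pose F X : rat := #|sumset X B|%:R / #|X|%:R.
pose P X := (X \subset A) && (X != set0).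
have PA : P A by rewrite /P subxx.
case: (@arg_minP _ _ _ A P F PA) => X /andP [sXA X_neq0] minX.
have card_gt0R Y : Y != set0 -> 0 < #|Y|%:R :> rat.
  by move=> Y0; rewrite ltr0n card_gt0.
have le_of Y : P Y -> (#|sumset X B| * #|Y| <= #|sumset Y B| * #|X|)%N.
  move=> PY; have := minX _ PY; case/andP: PY => _ Y0.
  rewrite /F ler_pdivrMr ?card_gt0R // mulrAC ler_pdivlMr ?card_gt0R //.
  by rewrite -!natrM ler_nat.
exists X; split=> //; first exact: le_of.
elim=> [|j IH].
  rewrite !expn0 muln1 mul1n sumset1 /translate.
  by rewrite (eq_imset (g := id)) ?imset_id // => x; rewrite addr0.
have H := @petridis X B (iterated_sumset B j).
rewrite /= sumsetA expnS mulnCA mulnA.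
have {}H : (#|sumset (sumset X B) (iterated_sumset B j)| * #|X| <=
          #|sumset X B| * #|sumset X (iterated_sumset B j)|)%N.
  apply: H => Z sZX; have [->|Z0] := eqVneq Z set0; first by rewrite cards0 muln0.
  by apply: le_of; rewrite /P Z0 (subset_trans sZX).
rewrite [(#|X| * _)%N]mulnC.
apply: (leq_trans (leq_mul H (leqnn _))).
by rewrite -mulnA expnS -mulnA leq_mul2l IH orbT.
Qed.

Lemma plunnecke_difference Y j : Y != set0 ->
  (#|iterated_sumset Y j| * #|Y| ^ j <= #|[set (x - y)%R | x in Y, y in Y]| ^ j * #|Y|)%N.
Proof.
move=> Y0; pose N := [set - y | y in Y] : {set V}.
have cardN : #|N| = #|Y| by rewrite card_imset //; apply: oppr_inj.
have N0 : N != set0 by rewrite -card_gt0 cardN card_gt0.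
have [X [sXN X0 ratio iter]] := @plunnecke_minimizer N Y N0.
have E : #|[set x - y | x in Y, y in Y]| = #|sumset N Y|.
  apply: eq_card => s; apply/imset2P/imset2P.
    by case=> x y Yx Yy ->; exists (- y) x => //; [apply: imset_f|rewrite addrC].
  case=> _ x /imsetP [y Yy ->] Yx ->.
  by exists x y => //; rewrite addrC.
rewrite E; rewrite cardN in ratio.
have X_gt0 : (0 < #|X|)%N by rewrite card_gt0.
have leJ : (#|iterated_sumset Y j| <= #|sumset X (iterated_sumset Y j)|)%N.
  case/set0Pn: X0 => x Xx; rewrite -(card_translate _ x) -sumset1 sumsetC.
  by apply: subset_leq_card; apply: sumset_subl; rewrite sub1set.
rewrite -(@leq_pmul2r (#|X| ^ j)) ?expn_gt0 ?X_gt0 //.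
apply: (@leq_trans (#|sumset X Y| ^ j * #|X| * #|Y| ^ j)).
  rewrite mulnAC leq_mul2r; apply/orP; right.
  by apply: leq_trans (iter j); rewrite leq_mul2r leJ orbT.
rewrite mulnAC -expnMn; apply: (@leq_trans ((#|sumset N Y| * #|X|) ^ j * #|X|)).
  by rewrite leq_mul2r; case: (j) => [|j']; rewrite ?orbT // leq_exp2r // ratio orbT.
rewrite expnMn mulnAC leq_mul2r; apply/orP; right.
by rewrite leq_mul2l -cardN subset_leq_card // orbT.
Qed.

End Sumsets.

Section Representations.
Variable V : finZmodType.
Implicit Types A B : {set V}.

Fixpoint reps A (k : nat) (s : V) : nat :=
  if k is k'.+1 then \sum_(x in A) reps A k' (s - x)%R else (s == 0).

Definition energy A k : nat := \sum_s reps A k s ^ 2.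

Lemma reps_add A j k s :
  reps A (j + k) s = (\sum_u reps A j u * reps A k (s - u)%R)%N.
Proof.
elim: j s => [|j IH] s /=.
  rewrite (bigD1 0) //= eqxx mul1n subr0 big1 ?addn0 // => u /negbTE ->.
  by rewrite mul0n.
under eq_bigr do rewrite IH.
under [RHS]eq_bigr do rewrite big_distrl /=.
rewrite [RHS]exchange_big /=; apply: eq_bigr => x _.
rewrite -(sum_shift (M := nat) (fun u => reps A j u * reps A k (s - x - u)%R)%N x).
by apply: eq_bigr => u _; congr (_ * reps A k _)%N; rewrite opprB addrA subrK.
Qed.

Lemma sum_reps A k : (\sum_s reps A k s = #|A| ^ k)%N.
Proof.
elim: k => [|k IH] /=.
  by rewrite (bigD1 0) //= eqxx big1 ?addn0 // => u /negbTE ->.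
rewrite exchange_big /= expnS -IH -sum_nat_const; apply: eq_bigr => x _.
exact: (sum_shift (M := nat) (fun s => reps A k s)).
Qed.

Lemma reps_subset A B k s : B \subset A -> (reps B k s <= reps A k s)%N.
Proof.
move=> /subsetP sBA; elim: k s => //= k IH s.
rewrite big_mkcond [leqRHS]big_mkcond /=; apply: leq_sum => x _.
by case: ifP => [/sBA ->|_ //].
Qed.

Lemma energy_subset A B k : B \subset A -> (energy B k <= energy A k)%N.
Proof.
by move=> sBA; apply: leq_sum => s _; rewrite leq_exp2r // reps_subset.
Qed.

Lemma reps_double_le A k s : (reps A (k + k) s <= energy A k)%N.
Proof.
rewrite reps_add -(@leq_pmul2l 2) //.
have -> : (2 * energy A k = \sum_u (reps A k u ^ 2 + reps A k (s - u)%R ^ 2))%N.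
  rewrite big_split /= mul2n -addnn; congr (_ + _)%N.
  by rewrite /energy (reindex_inj (inv_inj (subKr s))).
rewrite big_distrr /=; apply: leq_sum => u _; exact: nat_Cauchy.
Qed.

Lemma energy_double_le A k : (energy A (k + k) <= energy A k * #|A| ^ (k + k))%N.
Proof.
rewrite -sum_reps big_distrr /=; apply: leq_sum => s _.
by rewrite expnS expn1 leq_mul2r reps_double_le orbT.
Qed.

Lemma energy_le A k : (energy A k <= #|A| ^ (k + k))%N.
Proof.
rewrite expnD -{2}sum_reps big_distrr /=; apply: leq_sum => s _.
rewrite expnS expn1 leq_mul2r; apply/orP; right.
by rewrite -sum_reps (bigD1 s) //= leq_addr.
Qed.

Lemma energy_ge A k : (#|A| ^ (k + k) <= #|V| * energy A k)%N.
Proof.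
have := @cauchy_schwarz rat V (fun=> 1) (fun s => (reps A k s)%:R).
under eq_bigr do rewrite mul1r.
rewrite -natr_sum sum_reps -natrX -expnM muln2 -addnn.
under eq_bigr do rewrite expr1n.
rewrite sumr_const; under eq_bigr do rewrite -natrX.
by rewrite -natr_sum -natrM ler_nat.
Qed.

Lemma card_iterated_translate A (Y : {set V}) v k :
  (#|iterated_sumset [set x in A | (x + v)%R \in Y] k| <= #|iterated_sumset Y k|)%N.
Proof.
set B := [set x in A | _].
suff sBY s : s \in iterated_sumset B k -> s + v *+ k \in iterated_sumset Y k.
  rewrite -(card_translate _ (v *+ k)); apply: subset_leq_card.
  by apply/subsetP => _ /imsetP [s /sBY Hs ->].
elim: k s => [|k IH] s /=; first by rewrite !inE addr0.
case/imset2P => x y; rewrite inE => /andP [_ xvY] /IH yY ->.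
by rewrite mulrS addrACA mem_sumset.
Qed.

(* Pluennecke's inequality for the set given by Balog--Szemeredi--Gowers,
   applied to the law of a sum of [k.+1] uniform elements of [A]; some translate
   of that set contains many elements of [A]. *)
Lemma structured_subset (R : realFieldType) A k (Lam : R) :
  A != set0 -> 0 < Lam ->
  (energy A k.+1)%:R * #|A|%:R ^+ (k.+1 + k.+1) <=
     Lam * (energy A (k.+1 + k.+1))%:R ->
  exists B, [/\ B \subset A, #|A|%:R <= 8 * Lam * #|B|%:R &
    forall j, #|iterated_sumset B j|%:R * (energy A k.+1)%:R <=
      2 ^+ 33 * Lam ^+ 14 * (2 ^+ 39 * Lam ^+ 16) ^+ j * #|A|%:R ^+ (k.+1 + k.+1)].
Proof.
move=> A0 Lam_gt0 HE; pose a : R := #|A|%:R.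
have a_gt0 : 0 < a by rewrite ltr0n card_gt0.
pose f s : R := (reps A k.+1 s)%:R / a ^+ k.+1.
have ak_gt0 j : 0 < a ^+ j by apply: exprn_gt0.
have f_ge0 s : 0 <= f s by rewrite divr_ge0 // ltW.
have f_sum : \sum_s f s = 1.
  by rewrite -mulr_suml -natr_sum sum_reps natrX divff // gt_eqF.
pose e := (energy A k.+1)%:R / a ^+ (k.+1 + k.+1).
have f_sq : \sum_s f s ^+ 2 = e.
  under eq_bigr do rewrite expr_div_n -exprM muln2 -addnn.
  by rewrite -mulr_suml /e natr_sum; under [in RHS]eq_bigr do rewrite natrX.
have convE s : \sum_x f x * f (s - x) = (reps A (k.+1 + k.+1) s)%:R / a ^+ (k.+1 + k.+1).
  rewrite reps_add natr_sum mulr_suml; apply: eq_bigr => x _.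
  by rewrite natrM exprD invfM mulrACA.
have f_energy : e <= Lam * \sum_s (\sum_x f x * f (s - x)) ^+ 2.
  under eq_bigr do rewrite convE expr_div_n -natrX.
  rewrite -mulr_suml -natr_sum -/(energy _ _) /e ler_pdivrMr //.
  move: HE; rewrite -/a; move: (ak_gt0 (k.+1 + k.+1)%N); move: (a ^+ _) => P P_gt0.
  set E1 := _%:R; set E2 := _%:R => HE.
  have -> : Lam * (E2 / P ^+ 2) * P = Lam * E2 / P by field; apply: lt0r_neq0.
  by rewrite ler_pdivlMr.
have [Y [fY dY]] := balog_szemeredi_gowers f_ge0 f_sum f_sq Lam_gt0 f_energy.
have Y0 : Y != set0.
  by apply: contraTneq fY => ->; rewrite big_set0 mulr0 -ltNge.
have [v Hv] : exists v, a * \sum_(x in Y) f x <= #|[set x in A | x + v \in Y]|%:R.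
  apply: (@weighted_average_ge _ _ (fun v => (reps A k v)%:R / a ^+ k)).
  - by move=> v; rewrite divr_ge0 // ltW.
  - by rewrite -mulr_suml -natr_sum sum_reps natrX divff // gt_eqF.
  have -> : a * \sum_(x in Y) f x = (\sum_(s in Y) reps A k.+1 s)%:R / a ^+ k.
    rewrite natr_sum mulr_sumr mulr_suml; apply: eq_bigr => s _.
    by rewrite /f exprS invfM mulrCA mulVKf ?gt_eqF // mulrA.
  rewrite le_eqVlt; apply/orP; left; apply/eqP.
  under [RHS]eq_bigr do rewrite mulrAC -natrM.
  rewrite -mulr_suml -natr_sum; congr (_%:R / _).
  rewrite /= exchange_big /=.
  under [RHS]eq_bigr do rewrite -sum1dep_card big_mkcondr big_distrr /= big_mkcond.
  rewrite [RHS]exchange_big /= [LHS]big_mkcond /=; apply: eq_bigr => x _.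
  case: ifP => _; last by rewrite big1.
  rewrite big_mkcond -(sum_shift (M := nat) _ (- x)) /=; apply: eq_bigr => u _.
  by rewrite opprK addrK addrC; case: ifP => _; rewrite ?muln1 ?muln0.
exists [set x in A | x + v \in Y]; split.
- by apply/subsetP => x; rewrite inE => /andP [].
- apply: (@le_trans _ _ (8 * Lam * (a * \sum_(x in Y) f x))); last first.
    by rewrite ler_wpM2l // mulr_ge0 // ltW.
  by rewrite mulrCA ler_peMr // ltW.
move=> j; set c1 := 2 ^+ 33 * Lam ^+ 14 in dY *; set c2 := 2 ^+ 39 * Lam ^+ 16.
pose y : R := #|Y|%:R; have y_gt0 : 0 < y by rewrite ltr0n card_gt0.
set D : R := #|[set _ - _ | _ in _, _ in _]|%:R in dY.
have e_ge0 : 0 <= e by rewrite -f_sq sumr_ge0 // => s _; apply: sqr_ge0.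
have c2_ge0 : 0 <= c2 by rewrite mulr_ge0 // exprn_ge0 // ltW.
have y_large : 1 <= 64 * Lam ^+ 2 * (y * e).
  have : (\sum_(x in Y) f x) ^+ 2 <= y * e.
    have := cauchy_schwarz (fun x => (x \in Y)%:R) f; rewrite f_sq.
    rewrite (eq_bigr (fun x => if x \in Y then f x else 0)) => [|x _]; last first.
      by case: (x \in Y); rewrite ?mul1r ?mul0r.
    rewrite -big_mkcond /= => /le_trans; apply.
    rewrite (eq_bigr (fun x => if x \in Y then 1 else 0)) => [|x _]; last first.
      by case: (x \in Y); rewrite ?expr1n ?expr0n.
    by rewrite -big_mkcond sumr_const.
  have := ler_pM ler01 ler01 fY fY; nra.
have D_le : D <= c2 * y.
  apply: (@le_trans _ _ (D * (64 * Lam ^+ 2 * (y * e)))); first by rewrite ler_peMr // ler0n.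
  have -> : D * (64 * Lam ^+ 2 * (y * e)) = 64 * Lam ^+ 2 * y * (D * e) by ring.
  have -> : c2 * y = 64 * Lam ^+ 2 * y * c1 by rewrite /c1 /c2; ring.
  by rewrite ler_wpM2l // !mulr_ge0 // ltW.
have y_le : y <= D.
  case/set0Pn: (Y0) => z Yz; rewrite ler_nat -(card_imset Y (addIr (- z))).
  by apply: subset_leq_card; apply/subsetP => _ /imsetP [x Yx ->]; apply: imset2_f.
set J : R := #|iterated_sumset _ j|%:R.
have J_le : J <= c2 ^+ j * y.
  apply: (@le_trans _ _ #|iterated_sumset Y j|%:R); first by rewrite ler_nat card_iterated_translate.
  rewrite -(@ler_pM2r _ (y ^+ j)) ?exprn_gt0 //.
  have := plunnecke_difference j Y0; rewrite -(ler_nat R) !natrM !natrX => /le_trans.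
  apply; rewrite -/y mulrAC ler_wpM2r ?(ltW y_gt0) // -exprMn.
  by rewrite lerXn2r ?nnegrE ?ler0n // mulr_ge0 // ltW.
rewrite -ler_pdivrMr // -mulrA -/e.
apply: (@le_trans _ _ (c2 ^+ j * y * e)); first by rewrite ler_wpM2r.
rewrite -mulrA mulrC ler_wpM2r ?exprn_ge0 //.
by apply: le_trans dY; rewrite ler_wpM2r.
Qed.

End Representations.

(** * Popular sums *)

Section PopularSums.
Variable V : finZmodType.
Implicit Types A B Z : {set V}.

Definition tuples_with_sum B k (s : V) : {set {ffun 'I_k -> V}} :=
  [set b : {ffun 'I_k -> V} | [forall i, b i \in B] && (\sum_i b i == s)].

Definition popular (p : nat) A k (s : V) : bool :=
  [forall Z : {set V}, (#|Z| <= p)%N ==>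
     [exists b in tuples_with_sum (A :\: Z) k s, injectiveb b]].

Lemma card_tuples_fixed_coordinate B k s (a : 'I_k.+1) z :
  (#|[set b in tuples_with_sum B k.+1 s | b a == z]| <=
   #|tuples_with_sum B k (s - z)%R|)%N.
Proof.
pose h (b : {ffun 'I_k.+1 -> V}) := [ffun i : 'I_k => b (lift a i)].
set S := [set _ in _ | _].
rewrite -(@card_in_imset _ _ h S).
  apply: subset_leq_card; apply/subsetP => _ /imsetP [b + ->].
  rewrite !inE => /andP [/andP [/forallP bB /eqP <-] /eqP <-].
  apply/andP; split; first by apply/forallP => i; rewrite ffunE.
  rewrite (bigD1_ord a) //= [X in _ == X]addrC addKr.
  by apply/eqP/eq_bigr => i _; rewrite ffunE.
move=> b b'; rewrite !inE => /andP [_ /eqP Ez] /andP [_ /eqP Ez'] /ffunP E.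
apply/ffunP => i; have [j ->|->] := unliftP a i; last by rewrite Ez Ez'.
by have := E j; rewrite !ffunE.
Qed.

Lemma card_tuples_le_reps B k s : (#|tuples_with_sum B k s| <= reps B k s)%N.
Proof.
elim: k s => [|k IH] s.
  rewrite /=; case: eqVneq => [_|s0].
    by rewrite (leq_trans (max_card _)) // card_ffun card_ord expn0.
  rewrite leqn0 cards_eq0; apply/eqP/setP => b; rewrite !inE big_ord0 eq_sym.
  by rewrite (negbTE s0) andbF.
pose S x := [set b in tuples_with_sum B k.+1 s | b ord0 == x].
apply: (@leq_trans (\sum_(x in B) #|S x|)); last first.
  by apply: leq_sum => x _; apply: leq_trans (card_tuples_fixed_coordinate _ _ _ _) (IH _).
apply: leq_trans (leq_card_bigcup _ _); apply: subset_leq_card; apply/subsetP => b Hb.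
apply/bigcupP; exists (b ord0); last by rewrite inE Hb eqxx.
by move: Hb; rewrite inE => /andP [/forallP].
Qed.

Lemma sum_iterated_sumset B k (b : 'I_k -> V) :
  (forall i, b i \in B) -> \sum_i b i \in iterated_sumset B k.
Proof.
elim: k b => [|k IH] b bB /=; first by rewrite big_ord0 inE.
by rewrite big_ord_recl mem_sumset // IH.
Qed.

Definition unpopular_tuples p A B k : {set {ffun 'I_k -> V}} :=
  [set b : {ffun 'I_k -> V} |
     [&& [forall i, b i \in B], injectiveb b & ~~ popular p A k (\sum_i b i)]].

Lemma card_unpopular_tuples p A B k m : B \subset A ->
  (forall u, reps B k u <= m)%N ->
  (#|unpopular_tuples p A B k.+1| <= #|iterated_sumset B k.+1| * (k.+1 * p * m))%N.
Proof.
move=> /subsetP sBA Hm; pose S s := [set b in unpopular_tuples p A B k.+1 | \sum_i b i == s].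
apply: (@leq_trans (\sum_(s in iterated_sumset B k.+1) #|S s|)).
  apply: leq_trans (leq_card_bigcup _ _); apply: subset_leq_card; apply/subsetP => b Hb.
  apply/bigcupP; exists (\sum_i b i); last by rewrite inE Hb eqxx.
  by apply: sum_iterated_sumset; move: Hb; rewrite inE => /andP [/forallP].
rewrite -sum_nat_const; apply: leq_sum => s _.
have [pop|] := boolP (popular p A k.+1 s).
  rewrite (_ : S s = set0) ?cards0 //; apply/setP => b; rewrite !inE.
  by apply/negP => /andP [/and3P [_ _ /negP nop] /eqP E]; apply: nop; rewrite E.
case/forallPn => Z; rewrite negb_imply => /andP [leZ /existsPn Hno].
pose T (a : 'I_k.+1) z := [set b in tuples_with_sum B k.+1 s | b a == z].
apply: (@leq_trans (\sum_(a < k.+1) \sum_(z in Z) #|T a z|)).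
  apply: (@leq_trans #|\bigcup_(a < k.+1) \bigcup_(z in Z) T a z|).
    apply: subset_leq_card; apply/subsetP => b; rewrite !inE.
    case/andP=> /and3P [/forallP bB binj _] Es.
    have := Hno b; rewrite binj andbT inE Es andbT => /forallPn [a].
    rewrite inE negb_and negbK sBA // orbF => aZ.
    apply/bigcupP; exists a => //; apply/bigcupP; exists (b a) => //.
    by rewrite !inE Es eqxx andbT; apply/andP; split=> //; apply/forallP.
  apply: (leq_trans (leq_card_bigcup _ _)); apply: leq_sum => a _.
  exact: leq_card_bigcup.
apply: (@leq_trans (\sum_(a < k.+1) \sum_(z in Z) m)).
  apply: leq_sum => a _; apply: leq_sum => z _.
  exact: leq_trans (card_tuples_fixed_coordinate _ _ _ _) (leq_trans (card_tuples_le_reps _ _ _) (Hm _)).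
rewrite big_const_ord iter_addn_0 sum_nat_const mulnC -mulnA leq_mul2l leq_mul2r.
by rewrite leZ !orbT.
Qed.

End PopularSums.

Section Sampling.
Variables (V : finType) (B : {set V}) (M : nat).

Definition functions_into (k : nat) : {set {ffun 'I_k -> V}} :=
  [set f : {ffun 'I_k -> V} | [forall i, f i \in B]].

Lemma card_functions_into k : #|functions_into k| = (#|B| ^ k)%N.
Proof.
rewrite -[in RHS](card_ord k) -(card_ffun_on _ (mem B)); apply: eq_card => f.
by rewrite inE; apply/forallP/ffun_onP.
Qed.

Definition compose_index k (f : {ffun 'I_M -> V}) (t : {ffun 'I_k -> 'I_M}) :
  {ffun 'I_k -> V} := [ffun a => f (t a)].

Lemma card_restriction_in k (t : {ffun 'I_k -> 'I_M}) (Bad : {set {ffun 'I_k -> V}}) :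
  injective t ->
  (#|[set f in functions_into M | compose_index f t \in Bad]| * #|B| ^ k <=
   #|Bad| * #|B| ^ M)%N.
Proof.
move=> t_inj; pose S b := [set f in functions_into M | compose_index f t == b].
apply: (@leq_trans ((\sum_(b in Bad) #|S b|) * #|B| ^ k)).
  rewrite leq_mul2r; apply/orP; right.
  apply: leq_trans (leq_card_bigcup _ _); apply: subset_leq_card.
  apply/subsetP => f; rewrite inE => /andP [fB fbad].
  by apply/bigcupP; exists (compose_index f t) => //; rewrite inE fB eqxx.
rewrite big_distrl -sum_nat_const /=; apply: leq_sum => b _.
rewrite -card_functions_into -cardsX -(card_functions_into M).
pose g (u : {ffun 'I_M -> V} * {ffun 'I_k -> V}) : {ffun 'I_M -> V} :=
  [ffun i => if [pick a | t a == i] is Some a then u.2 a else u.1 i].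
have gt u a : g u (t a) = u.2 a.
  rewrite ffunE; case: pickP => [a' /eqP /t_inj -> //|/(_ a)].
  by rewrite eqxx.
have gn u i : (forall a, t a != i) -> g u i = u.1 i.
  by move=> H; rewrite ffunE; case: pickP => // a; rewrite (negbTE (H a)).
rewrite -(@card_in_imset _ _ g).
  apply: subset_leq_card; apply/subsetP => _ /imsetP [[f c] fc ->]; move: fc.
  rewrite !inE /= => /andP [/andP [/forallP fB _] /forallP cB].
  by apply/forallP => i; rewrite ffunE /=; case: pickP.
move=> [f c] [f' c']; rewrite !inE /= => /andP [/andP [_ /eqP fb] _].
move=> /andP [/andP [_ /eqP fb'] _] E; congr pair.
  apply/ffunP => i; case: (pickP (fun a => t a == i)) => [a /eqP <-|H].
    have /ffunP /(_ a) : compose_index f t = compose_index f' t by rewrite fb fb'.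
    by rewrite !ffunE.
  have tn a : t a != i by rewrite H.
  by have /ffunP /(_ i) := E; rewrite !gn.
by apply/ffunP => a; have /ffunP /(_ (t a)) := E; rewrite !gt.
Qed.

Lemma card_collisions (i j : 'I_M) : i != j ->
  (#|[set f in functions_into M | f i == f j]| * #|B| <= #|B| ^ M)%N.
Proof.
move=> ij; have [B0|B_gt0] := posnP #|B|; first by rewrite B0 muln0.
pose t : {ffun 'I_2 -> 'I_M} := [ffun a => if a == ord0 then i else j].
have t_inj : injective t.
  move=> a a'; rewrite !ffunE; have E (c : 'I_2) : c = if c == ord0 then ord0 else ord_max.
    by apply: val_inj; case: c => -[|[|]].
  case: ifP => Ha; case: ifP => Ha' Eij; rewrite (E a) (E a') Ha Ha' //.
    by rewrite Eij eqxx in ij.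
  by rewrite Eij eqxx in ij.
pose Bad := [set ([ffun=> x] : {ffun 'I_2 -> V}) | x in B].
rewrite -(@leq_pmul2r #|B|) // -mulnA mulnn mulnC mulnC [leqRHS]mulnC.
apply: (@leq_trans (#|Bad| * #|B| ^ M)); last first.
  by rewrite leq_mul2r leq_imset_card orbT.
apply: leq_trans (card_restriction_in _ t_inj); rewrite leq_mul2r; apply/orP; right.
apply: subset_leq_card; apply/subsetP => f; rewrite !inE => /andP [fB /eqP Ef].
rewrite fB /=; apply/imsetP; exists (f i); first by apply: (forallP fB).
by apply/ffunP => a; rewrite !ffunE; case: ifP.
Qed.

Lemma exists_sample k (Bad : {set {ffun 'I_k -> V}}) :
  (0 < #|B|)%N -> (2 * M ^ k * #|Bad| < #|B| ^ k)%N -> (2 * M ^ 2 <= #|B|)%N ->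
  exists f : {ffun 'I_M -> V},
    [/\ forall i, f i \in B, injective f &
        forall t : {ffun 'I_k -> 'I_M}, injective t -> compose_index f t \notin Bad].
Proof.
move=> B_gt0 fewBad largeB.
pose S1 := \bigcup_(t : {ffun 'I_k -> 'I_M} | injectiveb t)
  [set f in functions_into M | compose_index f t \in Bad].
pose S2 := \bigcup_(ij : 'I_M * 'I_M | ij.1 != ij.2)
  [set f in functions_into M | f ij.1 == f ij.2].
have card1 : (2 * #|S1| < #|B| ^ M)%N.
  rewrite -(@ltn_pmul2r (#|B| ^ k)) ?expn_gt0 ?B_gt0 //.
  apply: (@leq_ltn_trans (2 * M ^ k * #|Bad| * #|B| ^ M)); last first.
    by rewrite [ltnRHS]mulnC ltn_pmul2r ?expn_gt0 ?B_gt0.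
  rewrite -!mulnA leq_mul2l /=.
  apply: (@leq_trans (\sum_(t : {ffun 'I_k -> 'I_M}) #|Bad| * #|B| ^ M)); last first.
    by rewrite sum_nat_const card_ffun !card_ord.
  apply: (leq_trans (leq_mul (leq_card_bigcup _ _) (leqnn _))).
  rewrite big_distrl /= big_mkcond; apply: leq_sum => t _; case: ifP => // /injectiveP.
  exact: card_restriction_in.
have card2 : (2 * #|S2| <= #|B| ^ M)%N.
  rewrite -(@leq_pmul2r #|B|) //.
  apply: (@leq_trans (2 * (M ^ 2 * #|B| ^ M))); last first.
    by rewrite mulnA mulnC leq_mul2l largeB orbT.
  rewrite -!mulnA leq_mul2l /=.
  apply: (@leq_trans (\sum_(ij : 'I_M * 'I_M) #|B| ^ M)); last first.
    by rewrite sum_nat_const card_prod !card_ord -mulnA.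
  apply: (leq_trans (leq_mul (leq_card_bigcup _ _) (leqnn _))).
  rewrite big_distrl /= big_mkcond; apply: leq_sum => t _; case: ifP => //.
  exact: card_collisions.
have : (0 < #|functions_into M :\: (S1 :|: S2)|)%N.
  rewrite cardsD card_functions_into subn_gt0.
  apply: (@leq_ltn_trans #|S1 :|: S2|); first by rewrite subset_leq_card // subsetIr.
  by apply: (leq_ltn_trans (leq_card_setU _ _)); lia.
case/card_gt0P => f /setDP [fM]; rewrite in_setU negb_or => /andP [f1 f2].
move: (fM); rewrite inE => fB; exists f; split; first exact: (forallP fB).
  move=> i j E; apply/eqP; apply: contraR f2 => ij.
  by apply/bigcupP; exists (i, j) => //; rewrite inE fM /= E eqxx.
move=> t /injectiveP t_inj; apply: contra f1 => Ht; apply/bigcupP.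
by exists t => //; rewrite inE fM.
Qed.

End Sampling.

(** * Grouping a balanced zero sum *)

Section Grouping.
Variable T : eqType.
Implicit Types s w : seq T.

Lemma count_mem_sum s w : uniq s -> count (mem s) w = (\sum_(x <- s) count_mem x w)%N.
Proof.
elim: s => [|x s IH] /=; first by rewrite big_nil (eq_count (a2 := pred0)) ?count_pred0.
case/andP=> xs us; rewrite big_cons -IH // -count_predUI.
rewrite [X in (_ = _ + X)%N](eq_count (a2 := pred0)) ?count_pred0 ?addn0.
  by apply: eq_count => y; rewrite /= inE.
by move=> y /=; case: eqP => // ->; rewrite (negbTE xs).
Qed.

Lemma size_le_undup w m : (forall x, (count_mem x w <= m)%N) ->
  (size w <= size (undup w) * m)%N.
Proof.
move=> Hm; have -> : size w = count (mem (undup w)) w.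
  by apply/esym/eqP; rewrite -all_count; apply/allP => x; rewrite /= mem_undup.
rewrite count_mem_sum ?undup_uniq // -sum1_size big_distrl /=.
by apply: leq_sum => x _; rewrite mul1n.
Qed.

Lemma uniq_complement s w : uniq s -> {subset s <= w} ->
  exists w', perm_eq w (s ++ w').
Proof.
move=> us sw; have [w' Hw'] : {w' | perm_eq w ([seq x <- undup w | x \in s] ++ w')}.
  by apply: perm_to_subseq; apply: subseq_trans (undup_subseq w); apply: filter_subseq.
exists w'; rewrite (permPl Hw') perm_cat2r uniq_perm ?filter_uniq ?undup_uniq //.
by move=> x; rewrite mem_filter mem_undup andb_idr //; apply: sw.
Qed.

(* Each group takes all the elements whose multiplicity is maximal, so that
   the multiplicity bound decreases together with the number of groups. *)
Lemma split_into_groups m l w : size w = (m * l)%N ->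
  (forall x, (count_mem x w <= m)%N) ->
  exists gs : seq (seq T), [/\ perm_eq w (flatten gs), size gs = m &
    forall g, g \in gs -> uniq g /\ size g = l].
Proof.
elim: m w => [|m IH] w size_w Hm.
  by exists [::]; split=> //; rewrite (size0nil size_w).
pose full := [seq x <- undup w | count_mem x w == m.+1].
pose other := [seq x <- undup w | count_mem x w != m.+1].
have le_full : (size full <= l)%N.
  rewrite -(@leq_pmul2l m.+1) // -size_w.
  apply: (@leq_trans (count (mem full) w)); last exact: count_size.
  rewrite count_mem_sum ?filter_uniq ?undup_uniq // mulnC -sum1_size big_distrl /=.
  rewrite big_seq [leqRHS]big_seq; apply: leq_sum => x.
  by rewrite mem_filter => /andP [/eqP -> _]; rewrite mul1n.
have size_fo : (size full + size other)%N = size (undup w).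
  by rewrite !size_filter count_predC.
have le_undup : (l <= size (undup w))%N.
  by have := size_le_undup Hm; rewrite size_w mulnC leq_pmul2r.
pose g := full ++ take (l - size full) other.
have mem_take_other x : x \in take (l - size full) other ->
    x \in w /\ count_mem x w != m.+1.
  by move=> /mem_take; rewrite mem_filter mem_undup => /andP [].
have ug : uniq g.
  rewrite cat_uniq filter_uniq ?undup_uniq //= take_uniq ?filter_uniq ?undup_uniq // andbT.
  apply/hasPn => x /mem_take_other [_ /negbTE nx].
  by rewrite /= mem_filter /= nx.
have size_g : size g = l.
  by rewrite size_cat size_takel ?subnKC // leq_subLR size_fo.
have gw : {subset g <= w}.
  move=> x; rewrite mem_cat => /orP [|/mem_take_other [] //].
  by rewrite mem_filter mem_undup => /andP [].
have [w' Hw'] := uniq_complement ug gw.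
have [||gs [perm_gs size_gs Hgs]] := IH w'.
- by move/perm_size: Hw'; rewrite size_w size_cat size_g mulSn => /addnI.
- move=> x; have /permP /(_ (pred1 x)) := Hw'; rewrite count_cat => E.
  have := Hm x; rewrite leq_eqVlt => /orP [/eqP Ex|]; last first.
    by rewrite ltnS E; apply: leq_trans; apply: leq_addl.
  have xg : x \in g.
    rewrite mem_cat mem_filter Ex eqxx mem_undup /=.
    by rewrite -has_pred1 has_count Ex.
  by move: E; rewrite Ex (count_uniq_mem _ ug) xg add1n => -[->].
exists (g :: gs); split=> [||g'] /=; last first.
- by rewrite inE => /orP [/eqP -> //|/Hgs].
- by rewrite size_gs.
by rewrite (permPl Hw') perm_cat2l.
Qed.

End Grouping.

Section Assembly.
Variables (V : finZmodType) (A : {set V}) (p l : nat).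
Hypothesis l_gt0 : (0 < l)%N.

Lemma realize_sums (ss w0 : seq V) :
  all (popular p A l) ss -> uniq w0 -> {subset w0 <= A} ->
  (size w0 + size ss * l <= p)%N ->
  exists w, [/\ uniq w, {subset w <= A}, size w = (size w0 + size ss * l)%N &
    \sum_(x <- w) x = \sum_(x <- w0) x + \sum_(s <- ss) s].
Proof.
elim: ss w0 => [|s ss IH] w0 /=.
  by move=> _ u0 s0 _; exists w0; rewrite big_nil addr0 mul0n addn0.
case/andP=> /forallP /(_ [set x in w0]) /implyP + pop u0 s0; rewrite mulSn => pop_s leP.
have /pop_s /exists_inP [b] : (#|[set x in w0]| <= p)%N.
  by rewrite cardsE (card_uniqP u0) (leq_trans _ leP) ?leq_addr.
rewrite inE => /andP [/forallP bA /eqP Es] /injectiveP b_inj.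
pose t := [seq b i | i <- enum 'I_l].
have size_t : size t = l by rewrite size_map size_enum_ord.
have tA x : x \in t -> x \in A /\ x \notin w0.
  by case/mapP => i _ ->; have := bA i; rewrite !inE => /andP [-> ->].
have [|||w [uw wA size_w sum_w]] := IH (w0 ++ t) pop.
- rewrite cat_uniq u0 (map_inj_uniq b_inj) enum_uniq andbT /=.
  by apply/hasPn => x /tA [].
- by move=> x; rewrite mem_cat => /orP [/s0|/tA []].
- by rewrite size_cat size_t -addnA.
exists w; split=> //; first by rewrite size_w size_cat size_t addnA.
by rewrite sum_w big_cat /= big_map big_enum /= Es big_cons addrA.
Qed.

Lemma assemble_zero_sum (I : {set V}) (x : {ffun 'I_p -> V}) :
  (l <= p)%N -> I \subset A ->
  (forall b : {ffun 'I_l -> V}, injective b -> (forall i, b i \in I) ->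
     popular p A l (\sum_i b i)) ->
  (forall j, x j \in I) -> \sum_j x j = 0 ->
  (forall v, (#|[set j | x j == v]| <= p %/ l)%N) ->
  exists y : 'I_p -> V, [/\ injective y, forall i, y i \in A & \sum_i y i = 0].
Proof.
move=> le_lp /subsetP sIA popI xI sum_x bal.
pose m := (p %/ l)%N; pose r := (p %% l)%N.
have m_gt0 : (0 < m)%N by rewrite divn_gt0.
pose w := [seq x j | j <- enum 'I_p].
have size_w : size w = p by rewrite size_map size_enum_ord.
have wI v : v \in w -> v \in I by case/mapP => j _ ->.
have count_w v : (count_mem v w <= m)%N.
  by apply: leq_trans (bal v); rewrite -sum1_count big_map big_enum_cond sum1dep_card.
have le_undup : (l <= size (undup w))%N.
  rewrite -(@leq_pmul2r m) // mulnC; apply: leq_trans (size_le_undup count_w).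
  by rewrite size_w leq_divM.
pose rem := take r (undup w).
have urem : uniq rem by rewrite take_uniq ?undup_uniq.
have size_rem : size rem = r.
  by rewrite size_takel // (leq_trans _ le_undup) // ltnW // ltn_mod.
have remw : {subset rem <= w} by move=> v /mem_take; rewrite mem_undup.
have [w' perm_w'] := uniq_complement urem remw.
have [||gs [perm_gs size_gs Hgs]] := @split_into_groups _ m l w'.
- move/perm_size: perm_w'; rewrite size_w size_cat size_rem {1}(divn_eq p l) addnC.
  by move/addnI.
- move=> v; apply: leq_trans (count_w v).
  by have /permP -> := perm_w'; rewrite count_cat leq_addl.
pose ss := [seq \sum_(v <- g) v | g <- gs].
have mem_gs g v : g \in gs -> v \in g -> v \in I.
  move=> Hg Hv; apply: wI; rewrite (perm_mem perm_w') mem_cat (perm_mem perm_gs).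
  by apply/orP; right; apply/flattenP; exists g.
have [||||y [uy yA size_y sum_y]] := @realize_sums ss rem.
- apply/allP => _ /mapP [g Hg ->]; have [ug size_g] := Hgs g Hg.
  have E : \sum_(v <- g) v = \sum_i [ffun i : 'I_l => nth 0 g i] i.
    by rewrite (big_nth 0) size_g big_mkord; apply: eq_bigr => i _; rewrite ffunE.
  rewrite E; apply: popI => [i j|i]; rewrite !ffunE.
    move/eqP; rewrite nth_uniq ?size_g ?ltn_ord // => /eqP; exact: val_inj.
  by apply: (mem_gs g) => //; rewrite mem_nth // size_g.
- exact: urem.
- by move=> v /remw /wI /sIA.
- by rewrite size_rem size_map size_gs addnC -divn_eq.
have size_yp : size y = p by rewrite size_y size_rem size_map size_gs addnC -divn_eq.
exists (fun i => nth 0 y i); split=> [i j /eqP|i|].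
- by rewrite nth_uniq ?size_yp ?ltn_ord // => /eqP; apply: val_inj.
- by apply: yA; rewrite mem_nth // size_yp.
have -> : \sum_(i < p) nth 0 y i = \sum_(v <- y) v by rewrite (big_nth 0) size_yp big_mkord.
rewrite sum_y big_map -big_flatten -(perm_big _ perm_gs) -big_cat -(perm_big _ perm_w') /=.
by rewrite big_map big_enum.
Qed.

End Assembly.

(** * Choice of the scales *)

Section NormalizedEnergy.
Variables (R : realFieldType) (V : finZmodType) (A : {set V}).
Hypothesis A_neq0 : A != set0.
Let a : R := #|A|%:R.

Definition normalized_energy (k : nat) : R := (energy A k)%:R / #|A|%:R ^+ (k + k).
Let nE := normalized_energy.

Let a_gt0 : 0 < a. Proof. by rewrite ltr0n card_gt0. Qed.
Let ak_gt0 k : 0 < a ^+ k. Proof. exact: exprn_gt0. Qed.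

Lemma normalized_energy_ge k : 1 <= #|V|%:R * nE k.
Proof.
rewrite /nE /normalized_energy mulrA ler_pdivlMr // mul1r.
by have := energy_ge A k; rewrite -(ler_nat R) natrX natrM.
Qed.

Lemma normalized_energy_gt0 k : 0 < nE k.
Proof.
have := normalized_energy_ge k; have : 0 <= nE k by rewrite divr_ge0 // ltW.
by rewrite le_eqVlt => /orP [/eqP <-|//]; rewrite mulr0 ler10.
Qed.

Lemma normalized_energy_le1 k : nE k <= 1.
Proof.
rewrite ler_pdivrMr // mul1r.
by have := energy_le A k; rewrite -(ler_nat R) natrX.
Qed.

Lemma normalized_energy_double_le k : nE (k + k) <= nE k.
Proof.
rewrite /nE /normalized_energy ler_pdivrMr // (exprD _ (k + k) (k + k)).
rewrite mulrA divfK ?gt_eqF //.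
by have := energy_double_le A k; rewrite -(ler_nat R) natrM natrX.
Qed.

Lemma normalized_energy_iter_le l i j : (i <= j)%N ->
  nE (2 ^ j * l) <= nE (2 ^ i * l).
Proof.
elim: j => [|j IH]; first by rewrite leqn0 => /eqP ->.
rewrite leq_eqVlt => /orP [/eqP -> //|/IH]; apply: le_trans.
by rewrite expnS mul2n -addnn mulnDl normalized_energy_double_le.
Qed.

(* Pigeonhole: take the doubling with the smallest energy ratio. *)
Lemma exists_slow_doubling l J : (0 < J)%N ->
  exists j, let Lam := nE (2 ^ j * l) / nE (2 ^ j.+1 * l) in
    [/\ (j < J)%N, 1 <= Lam & Lam ^+ J <= nE l / nE (2 ^ J * l)].
Proof.
case: J => // J _; pose rho j := nE (2 ^ j * l) / nE (2 ^ j.+1 * l).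
case: (@arg_minP _ _ _ (ord0 : 'I_J.+1) xpredT (fun j => rho j) isT) => j _ minj.
have rho_ge1 i : 1 <= rho i.
  by rewrite ler_pdivlMr ?normalized_energy_gt0 // mul1r normalized_energy_iter_le.
exists j; split; [exact: ltn_ord|exact: rho_ge1|].
have tele m : \prod_(i < m) rho i = nE l / nE (2 ^ m * l).
  elim: m => [|m IH].
    by rewrite big_ord0 mul1n divff // gt_eqF // normalized_energy_gt0.
  rewrite big_ord_recr IH /= /rho mulrA divfK // gt_eqF //.
  exact: normalized_energy_gt0.
rewrite -tele -[X in _ ^+ X]card_ord -prodr_const.
apply: ler_prod => i _; rewrite minj // andbT.
exact: le_trans ler01 (rho_ge1 j).
Qed.

End NormalizedEnergy.

(* The factor 31 lets [Lam ^+ doublings l] absorb all the powers of [Lam] lost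
   to Balog--Szemeredi--Gowers and Pluennecke, see [structure_constants_le]. *)
Definition doublings (l : nat) : nat := (31 * (2 * l).+1)%N.

Fixpoint scale (i : nat) : nat :=
  if i is i'.+1 then (2 ^ doublings (scale i') * scale i')%N else 1%N.

Lemma scale_gt0 i : (0 < scale i)%N.
Proof. by elim: i => //= i IH; rewrite muln_gt0 expn_gt0. Qed.

Lemma scale_mono i j : (i <= j)%N -> (scale i <= scale j)%N.
Proof.
elim: j => [|j IH]; first by rewrite leqn0 => /eqP ->.
rewrite leq_eqVlt => /orP [/eqP -> //|/IH] /leq_trans; apply.
by rewrite /= leq_pmull // expn_gt0.
Qed.

Lemma exists_stable_scale (R : realFieldType) (V : finZmodType) (A : {set V}) T :
  A != set0 -> (#|V| ^ 4 < #|A| ^ T)%N ->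
  exists2 i, (i < T)%N &
    normalized_energy R A (scale i) ^+ 4 <
    #|A|%:R * normalized_energy R A (scale i.+1) ^+ 4.
Proof.
move=> A0 ltVA; pose nE k := normalized_energy R A k.
case: (pickP [pred i : 'I_T | nE (scale i) ^+ 4 < #|A|%:R * nE (scale i.+1) ^+ 4]).
  by move=> i Hi; exists i.
move=> no; exfalso.
have step i : (i <= T)%N -> #|A|%:R ^+ i * nE (scale i) ^+ 4 <= 1.
  elim: i => [_|i IH ltiT].
    by rewrite expr0 mul1r exprn_ile1 ?normalized_energy_le1 // ltW // normalized_energy_gt0.
  apply: le_trans (IH (ltnW ltiT)); rewrite exprSr -mulrA ler_wpM2l ?exprn_ge0 //.
  by have /negbT := no (Ordinal ltiT); rewrite /= -leNgt.
have H : (#|A|%:R : R) ^+ T <= #|V|%:R ^+ 4.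
  have V1 : 1 <= #|V|%:R ^+ 4 * nE (scale T) ^+ 4.
    by rewrite -exprMn exprn_ege1 // normalized_energy_ge.
  apply: (@le_trans _ _ (#|A|%:R ^+ T * (#|V|%:R ^+ 4 * nE (scale T) ^+ 4))).
    by rewrite ler_peMr // exprn_ge0.
  by rewrite mulrCA ler_piMr ?exprn_ge0 // step.
by move: H; rewrite -!natrX ler_nat leqNgt ltVA.
Qed.

Lemma structure_constants_le (R : realFieldType) (Lam tau : R) K :
  (0 < K)%N -> 1 <= Lam -> Lam ^+ (31 * K) <= tau ->
  2 ^+ 33 * Lam ^+ 14 * (2 ^+ 39 * Lam ^+ 16) ^+ K * (8 * Lam) ^+ K <=
    2 ^+ (75 * K) * tau.
Proof.
move=> K_gt0 Lam_ge1 Lam_K; have Lam_ge0 := le_trans ler01 Lam_ge1.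
have -> : 8 = 2 ^+ 3 :> R by ring.
rewrite (exprMn K (2 ^+ 39)) (exprMn K (2 ^+ 3)) -!exprM; set LHS := (X in X <= _).
have -> : LHS = 2 ^+ (33 + 39 * K + 3 * K) * Lam ^+ (14 + 16 * K + K).
  rewrite /LHS (exprD _ (33 + 39 * K) (3 * K)) (exprD _ 33 (39 * K)).
  rewrite (exprD _ (14 + 16 * K) K) (exprD _ 14 (16 * K)).
  move: (2 ^+ 33) (Lam ^+ 14) (2 ^+ (39 * K)) (Lam ^+ (16 * K)) (2 ^+ (3 * K)) (Lam ^+ K).
  by move=> ? ? ? ? ? ?; ring.
apply: ler_pM; rewrite ?exprn_ge0 //.
  by rewrite ler_weXn2l ?ler1n //; lia.
by apply: le_trans Lam_K; rewrite ler_weXn2l //; lia.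
Qed.

Lemma sample_square_le M K p : (0 < M)%N -> (1 < K)%N -> (0 < p)%N ->
  (16 * M ^ 2 <= 2 * M ^ K * (K * p) * 2 ^ (75 * K))%N.
Proof.
move=> M_gt0 K_gt1 p_gt0.
have -> : (2 * M ^ K * (K * p) * 2 ^ (75 * K) = 2 ^ (75 * K).+1 * (M ^ K * (K * p)))%N.
  by rewrite expnS; move: (2 ^ (75 * K))%N (M ^ K)%N => u v; ring.
apply: leq_mul; first by rewrite (@leq_exp2l 2 4) //; lia.
rewrite -[leqLHS]muln1 leq_mul ?muln_gt0 ?(ltnW K_gt1) //.
by rewrite leq_pexp2l.
Qed.

Lemma exists_popular_sample (R : realFieldType) (V : finZmodType) (A : {set V})
    p M l :
  A != set0 -> (0 < l)%N -> (0 < M)%N -> (0 < p)%N ->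
  normalized_energy R A l ^+ 4 <
    #|A|%:R * normalized_energy R A (2 ^ doublings l * l) ^+ 4 ->
  ((2 * M ^ (2 * l).+1 * ((2 * l).+1 * p) * 2 ^ (75 * (2 * l).+1)) ^ 2 <= #|A|)%N ->
  exists f : {ffun 'I_M -> V}, [/\ forall i, f i \in A, injective f &
    forall t : {ffun 'I_((2 * l).+1) -> 'I_M}, injective t ->
      popular p A (2 * l).+1 (\sum_i f (t i))].
Proof.
move=> A0 l_gt0 M_gt0 p_gt0 stable; set K := (2 * l).+1; set X := (_ * _)%N => leX.
pose nE k := normalized_energy R A k.
have nE_gt0 k : 0 < nE k by apply: normalized_energy_gt0.
have [j] := @exists_slow_doubling R V A A0 l (doublings l) isT.
set Lam := _ / _; set tau := _ / _ => -[ltj Lam_ge1 Lam_tau].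
have a_gt0 : 0 < #|A|%:R :> R by rewrite ltr0n card_gt0.
have Lam_gt0 : 0 < Lam by apply: lt_le_trans ltr01 Lam_ge1.
have tau_ge1 : 1 <= tau by apply: le_trans Lam_tau; apply: exprn_ege1.
have tau4 : tau ^+ 4 < #|A|%:R.
  by rewrite expr_div_n ltr_pdivrMr // exprn_gt0 // nE_gt0.
have Xtau : X%:R * tau ^+ 2 < #|A|%:R.
  have : (X%:R * tau ^+ 2) ^+ 2 < #|A|%:R ^+ 2.
    rewrite exprMn -exprM [ltRHS]expr2; apply: (@le_lt_trans _ _ (#|A|%:R * tau ^+ 4)).
      by rewrite ler_wpM2r ?exprn_ge0 ?(le_trans ler01 tau_ge1) // -natrX ler_nat.
    by rewrite ltr_pM2l.
  by rewrite ltr_pXn2r // nnegrE ?ler0n // mulr_ge0 ?ler0n // sqr_ge0.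
have Lam_K : Lam ^+ (31 * K) <= tau by [].
have Lam_le : Lam <= tau.
  by apply: le_trans Lam_K; rewrite -[leLHS]expr1 ler_weXn2l // muln_gt0.
have tau_le : tau <= tau ^+ 2 by rewrite -[leLHS]expr1 ler_weXn2l.
pose k := (2 ^ j * l)%N; have k_gt0 : (0 < k)%N by rewrite muln_gt0 expn_gt0.
have [B [sBA cardB iterB]] : exists B : {set V}, [/\ B \subset A, #|A|%:R <= 8 * Lam * #|B|%:R &
    forall i, #|iterated_sumset B i|%:R * nE k <=
      2 ^+ 33 * Lam ^+ 14 * (2 ^+ 39 * Lam ^+ 16) ^+ i].
  have := @structured_subset V R A k.-1 Lam A0 Lam_gt0; rewrite prednK //.
  have Lam_eq : Lam = nE k / nE (k + k)%N.
    by rewrite /Lam /k -mulnDl addnn -mul2n -expnS.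
  case=> [|B [sBA cardB iterB]].
    have : nE k = Lam * nE (k + k)%N by rewrite Lam_eq divfK // gt_eqF.
    rewrite /nE /normalized_energy (exprD _ (k + k) (k + k)).
    have : 0 < (#|A|%:R : R) ^+ (k + k) by apply: exprn_gt0.
    move: (_ ^+ (k + k)) => P P_gt0; set E1 := _%:R; set E2 := _%:R => HE.
    have -> : E1 * P = E1 / P * P ^+ 2 by field; apply: lt0r_neq0.
    rewrite HE le_eqVlt; apply/orP; left; apply/eqP.
    by field; apply: lt0r_neq0.
  exists B; split=> // i; rewrite /nE /normalized_energy mulrA ler_pdivrMr ?exprn_gt0 //.
have B_gt0 : (0 < #|B|)%N.
  by rewrite lt0n; apply: contraTneq cardB => ->; rewrite mulr0 -ltNge.
pose Bad := unpopular_tuples p A B K.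
have card_Bad : (#|Bad| <= #|iterated_sumset B K| * (K * p * energy A l))%N.
  apply: card_unpopular_tuples => // u.
  by rewrite mul2n -addnn (leq_trans (reps_double_le _ _ _)) // energy_subset.
pose c : R := 2 ^+ 33 * Lam ^+ 14 * (2 ^+ 39 * Lam ^+ 16) ^+ K.
have Lam_ge0 := ltW Lam_gt0.
have c_ge0 : 0 <= c.
  by apply: mulr_ge0; [apply: mulr_ge0|apply: exprn_ge0; apply: mulr_ge0]; apply: exprn_ge0.
have BadR : #|Bad|%:R <= (K * p)%:R * c * tau * #|A|%:R ^+ (2 * l).
  have El : (energy A l)%:R = nE l * #|A|%:R ^+ (2 * l).
    by rewrite mul2n -addnn divfK // gt_eqF // exprn_gt0.
  have ratio : nE l / nE k <= tau.
    by rewrite ler_wpM2l ?(ltW (nE_gt0 _)) // lef_pV2 ?posrE ?nE_gt0 // normalized_energy_iter_le // ltnW.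
  move: card_Bad; rewrite -(ler_nat R) => /le_trans; apply.
  rewrite !natrM El; have := iterB K; rewrite -/c -ler_pdivlMr // => H.
  have Kp_ge0 : 0 <= K%:R * p%:R :> R by rewrite mulr_ge0 ?ler0n.
  have al_ge0 : 0 <= #|A|%:R ^+ (2 * l) :> R by rewrite exprn_ge0 ?ler0n.
  apply: (@le_trans _ _ (c / nE k * (K%:R * p%:R * (nE l * #|A|%:R ^+ (2 * l))))).
    by rewrite ler_wpM2r // mulr_ge0 // mulr_ge0 // ltW.
  have -> : c / nE k * (K%:R * p%:R * (nE l * #|A|%:R ^+ (2 * l))) =
    K%:R * p%:R * c * (nE l / nE k) * #|A|%:R ^+ (2 * l) by ring.
  by rewrite ler_wpM2r // ler_wpM2l // mulr_ge0.
have constants : c * (8 * Lam) ^+ K <= 2 ^+ (75 * K) * tau.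
  exact: structure_constants_le.
have few : (2 * M ^ K * #|Bad| < #|B| ^ K)%N.
  rewrite -(ltr_nat R) !natrM !natrX.
  have LK : 0 < (8 * Lam) ^+ K by rewrite exprn_gt0 // mulr_gt0.
  rewrite -(ltr_pM2l LK) -exprMn.
  apply: (@lt_le_trans _ _ (#|A|%:R ^+ K)); last first.
    by rewrite lerXn2r // nnegrE ?ler0n // mulr_ge0 // mulr_ge0.
  rewrite [ltRHS]exprS; apply: (@le_lt_trans _ _ (X%:R * tau ^+ 2 * #|A|%:R ^+ (2 * l))); last first.
    by rewrite ltr_pM2r // exprn_gt0.
  apply: (@le_trans _ _ ((8 * Lam) ^+ K * (2 * M%:R ^+ K * ((K * p)%:R * c * tau * #|A|%:R ^+ (2 * l))))).
    by rewrite ler_wpM2l ?(ltW LK) // ler_wpM2l // mulr_ge0 ?exprn_ge0 ?ler0n.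
  have -> : (8 * Lam) ^+ K * (2 * M%:R ^+ K * ((K * p)%:R * c * tau * #|A|%:R ^+ (2 * l))) =
    2 * M%:R ^+ K * (K * p)%:R * tau * #|A|%:R ^+ (2 * l) * (c * (8 * Lam) ^+ K) by ring.
  have -> : X%:R * tau ^+ 2 * #|A|%:R ^+ (2 * l) =
    2 * M%:R ^+ K * (K * p)%:R * tau * #|A|%:R ^+ (2 * l) * (2 ^+ (75 * K) * tau).
    by rewrite /X !natrM !natrX; ring.
  apply: ler_wpM2l => //; apply: mulr_ge0; last exact: exprn_ge0.
  apply: mulr_ge0; last exact: le_trans ler01 tau_ge1.
  by apply: mulr_ge0 => //; apply: mulr_ge0 => //; apply: exprn_ge0.
have large : (2 * M ^ 2 <= #|B|)%N.
  have X_ge : (16 * M ^ 2 <= X)%N by apply: sample_square_le => //; rewrite ltnS muln_gt0.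
  have Lam8_gt0 : 0 < 8 * Lam by apply: mulr_gt0.
  rewrite -(ler_nat R) -(ler_pM2l Lam8_gt0).
  apply: le_trans cardB; apply: ltW; apply: le_lt_trans Xtau.
  have -> : 8 * Lam * (2 * M ^ 2)%:R = (16 * M ^ 2)%:R * Lam by rewrite !natrM; ring.
  by rewrite ler_pM ?ler0n ?ler_nat ?(ltW Lam_gt0) // (le_trans Lam_le).
have [f [fB f_inj Hf]] := exists_sample B_gt0 few large.
have /subsetP sBA' := sBA.
exists f; split=> // [i|t t_inj]; first exact: sBA'.
have := Hf t t_inj; rewrite inE !negb_and negbK.
have E : \sum_i f (t i) = \sum_i compose_index f t i.
  by apply: eq_bigr => i _; rewrite ffunE.
case/or3P => [/forallPn [i]|/negP []|]; last by rewrite E.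
  by rewrite ffunE fB.
by apply/injectiveP => i i'; rewrite !ffunE => /f_inj /t_inj.
Qed.

Section Constants.
Variables (kappa p : nat).

Definition sample_constant : nat := (3 * p * (2 ^ (p * p)).+1 ^ (p * p)).+1.

Definition leading_constant : nat :=
  ((2 * sample_constant ^ kappa * (kappa * p) * 2 ^ (75 * kappa)) ^ 2)%N.

Definition growth_constant : nat := (kappa + 2 ^ (2 * (kappa * kappa.+1)))%N.

Lemma sample_size_le n :
  ((p * (2 * 2 ^ (n + n * kappa)).+1 * (2 ^ (p * p)).+1 ^ (p * p)).+1 <=
   sample_constant * 2 ^ (kappa.+1 * n))%N.
Proof.
have -> : (n + n * kappa = kappa.+1 * n)%N by ring.
rewrite /sample_constant; set y := (2 ^ (kappa.+1 * n))%N; set w := (_.+1 ^ _)%N.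
have y_gt0 : (0 < y)%N by rewrite expn_gt0.
have : (p * w * (2 * y).+1 <= p * w * (3 * y))%N by rewrite leq_mul2l; apply/orP; right; lia.
by nia.
Qed.

Lemma sample_condition n M K : (0 < M)%N -> (K <= kappa)%N ->
  (M <= sample_constant * 2 ^ (kappa.+1 * n))%N ->
  ((2 * M ^ K * (K * p) * 2 ^ (75 * K)) ^ 2 <= leading_constant * growth_constant ^ n)%N.
Proof.
move=> M_gt0 leK leM.
apply: (@leq_trans (leading_constant * (2 ^ (2 * (kappa * kappa.+1))) ^ n)); last first.
  by rewrite leq_mul2l; case: (n) => [|m]; rewrite ?expn0 ?leqnn ?orbT // leq_exp2r // leq_addl orbT.
pose y := (2 ^ (kappa.+1 * n))%N.
have -> : ((2 ^ (2 * (kappa * kappa.+1))) ^ n = (y ^ kappa) ^ 2)%N.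
  by rewrite /y -!expnM; congr (2 ^ _)%N; ring.
rewrite /leading_constant -expnMn leq_exp2r //.
have le1 : (M ^ K <= sample_constant ^ kappa * y ^ kappa)%N.
  rewrite -expnMn; apply: (@leq_trans (M ^ kappa)); first by rewrite leq_pexp2l.
  have mono k : (M ^ k <= (sample_constant * y) ^ k)%N.
    by case: k => // k; rewrite leq_exp2r.
  exact: mono.
have le2 : (K * p <= kappa * p)%N by rewrite leq_mul2r leK orbT.
have le3 : (2 ^ (75 * K) <= 2 ^ (75 * kappa))%N by rewrite leq_pexp2l // leq_mul2l leK orbT.
apply: (leq_trans (leq_mul (leq_mul (leq_mul (leqnn 2) le1) le2) le3)).
move: (sample_constant ^ kappa)%N (y ^ kappa)%N (2 ^ (75 * kappa))%N => u v w.
by rewrite leq_eqVlt; apply/orP; left; apply/eqP; ring.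
Qed.

End Constants.

Theorem theorem1p2 (R : realType) (eps : R) (eps_gt0 : 0 < eps) :
  exists C : R, forall p : nat, prime p ->
  exists D : R, forall n : nat, (0 < n)%N ->
  forall A : {set 'rV['F_p]_n}, ~ has_distinct_zero_sum A ->
  #|A|%:R <= D * (C * p%:R `^ eps) ^+ n.
Proof.
have [T T_gt0 epsT] : exists2 T : nat, (0 < T)%N & 4 <= eps * T%:R.
  exists (Num.bound (4 / eps)).+1 => //; rewrite mulrC -ler_pdivrMr //.
  have := archi_boundP (ltW (divr_gt0 (ltr0Sn R 3) eps_gt0)) => /ltW /le_trans; apply.
  by rewrite ler_nat.
pose kappa := (2 * scale T).+1.
have kappa_gt2 : (2 < kappa)%N by have := scale_gt0 T; rewrite /kappa; lia.
exists (growth_constant kappa)%:R => p p_pr.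
have p_gt0 := prime_gt0 p_pr.
exists (leading_constant kappa p)%:R => n n_gt0 A noA.
have C_ge1 : (1 <= growth_constant kappa)%N by rewrite /growth_constant; lia.
have D_ge1 : (1 <= leading_constant kappa p)%N.
  by rewrite /leading_constant expn_gt0 !muln_gt0 !expn_gt0 p_gt0.
have p_eps : 1 <= p%:R `^ eps :> R.
  by rewrite -[leLHS](powRr0 p%:R) ler_powR ?ler1n // ltW.
rewrite leNgt; apply/negP => ltA; apply: noA.
have cardV : #|{: 'rV['F_p]_n}| = (p ^ n)%N by rewrite card_mx card_Fp // mul1n.
have large1 : (leading_constant kappa p * growth_constant kappa ^ n < #|A|)%N.
  rewrite -(ltr_nat R); apply: le_lt_trans ltA; rewrite natrM natrX.
  rewrite ler_wpM2l ?ler0n // lerXn2r ?nnegrE ?mulr_ge0 ?ler0n ?powR_ge0 //.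
  by rewrite ler_peMr ?ler0n.
have ltkp : (kappa < p)%N.
  rewrite ltnNge; apply/negP => lepk; move: large1; rewrite ltnNge => /negP; apply.
  apply: (leq_trans (max_card _)); rewrite cardV.
  apply: (@leq_trans (growth_constant kappa ^ n)); last by rewrite leq_pmull.
  by rewrite leq_exp2r // (leq_trans lepk) // leq_addr.
have A0 : A != set0 by rewrite -card_gt0 (leq_ltn_trans _ large1).
have large2 : (#|{: 'rV['F_p]_n}| ^ 4 < #|A| ^ T)%N.
  rewrite cardV -(ltr_nat R) !natrX.
  have : (p%:R `^ eps) ^+ n < #|A|%:R :> R.
    apply: le_lt_trans ltA; rewrite exprMn mulrA ler_peMl ?exprn_ge0 ?powR_ge0 //.
    by rewrite -natrX -natrM ler1n muln_gt0 D_ge1 expn_gt0 C_ge1.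
  move=> H; apply: (@le_lt_trans _ _ (((p%:R `^ eps) ^+ n) ^+ T)).
    rewrite -exprM -exprM (mulnC n T) (mulnC n 4) !exprM.
    rewrite lerXn2r ?nnegrE ?exprn_ge0 ?powR_ge0 ?ler0n //.
    rewrite -(powR_mulrn T) ?powR_ge0 // -powRrM -powR_mulrn ?ler0n //.
    by rewrite ler_powR // ler1n.
  by rewrite ltrXn2r ?exprn_ge0 ?powR_ge0 // -lt0n.
have [i ltiT stable] := @exists_stable_scale R _ A T A0 large2.
pose K := (2 * scale i).+1.
have leK : (K <= kappa)%N by rewrite ltnS leq_mul2l scale_mono // ltnW.
pose M := (p * (2 * 2 ^ (n + n * kappa)).+1 * (2 ^ (p * p)).+1 ^ (p * p)).+1.
have leM : (M <= sample_constant p * 2 ^ (kappa.+1 * n))%N by apply: sample_size_le.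
have cond := leq_trans (sample_condition (ltn0Sn _) leK leM) (ltnW large1).
have [f [fA f_inj popf]] :=
  exists_popular_sample A0 (scale_gt0 i) (ltn0Sn _) p_gt0 stable cond.
pose I : {set 'rV['F_p]_n} := [set f j | j in 'I_M].
have ltI : (p * (2 * 2 ^ (n + n * kappa)).+1 * (2 ^ (p * p)).+1 ^ (p * p) < #|I|)%N.
  by rewrite card_imset // card_ord.
have [x [xI sum_x bal]] := exists_balanced_solution p_pr (ltn_trans kappa_gt2 ltkp)
  (ltnW kappa_gt2) (ltnW ltkp) ltI.
apply: (@assemble_zero_sum _ A p K _ I x) => //.
- exact: leq_trans leK (ltnW ltkp).
- by apply/subsetP => _ /imsetP [j _ ->].
- move=> b b_inj bI.
  have /fin_all_exists [t Ht] : forall a, exists j, b a = f j.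
    by move=> a; have /imsetP [j _ ->] := bI a; exists j.
  have := popf [ffun a => t a]; under eq_bigr do rewrite ffunE -Ht.
  apply=> a a'; rewrite !ffunE => E; apply: b_inj.
  by rewrite !Ht E.
- move=> v; have := bal v; rewrite -leq_divRL ?(ltn_trans _ kappa_gt2) // => /leq_trans; apply.
  exact: leq_div2l.
Qed.
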